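(* Let $\mathcal{G}$ be a $3$-regular planar lattice graph, invariant under the lattice $\Lambda\cong\mathbb{Z}^2$, such that $G=\mathcal{G}/\Lambda$ and its dual $G^*$ on the torus are $2$-connected, all their faces are topological disks, and each edge of $G$ intersects its dual edge exactly once and intersects no other edge of $G^*$. Let $\mathcal{G}'$ be the medial graph of $\mathcal{G}$. If $$\nu^{\lozenge}(\mathcal{G})\leq2\pi z_{\mathcal{G}},$$ then $$\nu^{\lozenge}(\mathcal{G}')<2\pi z_{\mathcal{G}'}.$$
   Context: A planar lattice graph $\mathcal{G}$ is a connected locally finite planar graph embedded in $\mathbb{R}^2$ that is invariant under the translation action of a lattice $\Lambda\cong\mathbb{Z}^2$; $G=\mathcal{G}/\Lambda$ is the quotient graph on the torus $T^2=\mathbb{R}^2/\Lambda$, with vertex, edge and face sets $VG,EG,FG$, and $G^*$ is its dual graph on $T^2$. Medial graph: the medial graph $\mathcal{G}'$ has one vertex for each edge of $\mathcal{G}$, and for each corner of each face of $\mathcal{G}$ an edge joining the two vertices corresponding to the two consecutive edges at that corner. For $3$-regular $\mathcal{G}$ it is equivalently obtained by subdividing each edge once and then performing a $Y$-$\Delta$ transformation at every $3$-valent vertex. It is $4$-regular and $\Lambda$-invariant. Spanning tree entropy: $z_{\mathcal{G}}=\lim_{n\to\infty}\frac{\log\tau(\Gamma_n)}{|V\Gamma_n|}$, where $\Gamma_n$ is the exhaustive nested sequence of finite connected planar graphs given by $n\times n$ copies of the $\Lambda$-fundamental domain of $\mathcal{G}$, $\tau$ is the number of spanning trees, and $V\Gamma_n$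 is the vertex set. Bipyramid volume: Let $L(\theta)=-\int_0^\theta\log|2\sin t|\,dt$, and let $B_n$ ($n\ge 2$) be the hyperbolic regular ideal bipyramid over an $n$-gon, with $\mathrm{vol}(B_n)=2n\,L(\pi/n)$ (so $\mathrm{vol}(B_2)=0$). With $|f|$ the degree of a face $f$, $\mathrm{vol}^{\lozenge}(G)=\sum_{f\in FG}\mathrm{vol}(B_{|f|})$, and $\nu^{\lozenge}(\mathcal{G})=\frac{\mathrm{vol}^{\lozenge}(G)+\mathrm{vol}^{\lozenge}(G^* )}{|VG|}$. *)

(* Defs.v *)
From HB Require Import structures.
From Stdlib Require Import Relation_Operators.
From mathcomp Require Import all_boot all_order all_algebra finmap.
From mathcomp Require Import all_classical all_reals all_analysis.
Import Order.TTheory GRing.Theory Num.Theory numFieldNormedType.Exports.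

Set Implicit Arguments.
Unset Strict Implicit.
Unset Printing Implicit Defensive.

Local Open Scope classical_set_scope.
Local Open Scope ring_scope.

(** * Combinatorial maps

    An embedded graph is recorded by its darts (oriented edges): [opp] reverses
    a dart and [rot x] is the next dart around the initial vertex of [x].
    Vertices are the orbits of [rot], edges the orbits [{x, opp x}], and faces
    the orbits of [turn], which sends [x] to the next dart along the face on
    the left of [x] (when [rot] is read counterclockwise).  The type of darts
    may be infinite. *)

Record cmap (D : Type) := CMap {
  rot : D -> D;
  unrot : D -> D;
  opp : D -> D;
  rotK : cancel rot unrot;
  unrotK : cancel unrot rot;
  oppK : involutive opp;
  opp_neq : forall x, opp x <> x }.

Section Maps.
Variables (D : Type) (M : cmap D).

Definition turn (x : D) : D := unrot M (opp M x).

(* Connectedness in the subgraph that has all the vertices of [M] but only the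
   edges with a dart in [T], [T] being understood to be stable under [opp]. *)
Definition linked (T : set D) : D -> D -> Prop :=
  clos_refl_sym_trans D (fun x y => y = rot M x \/ (T x /\ y = opp M x)).

Definition same_vertex : D -> D -> Prop := linked set0.

Definition connected_map : Prop := forall x y, linked setT x y.

Definition regular (k : nat) : Prop :=
  forall x, ([set y | same_vertex x y] #= `I_k)%card.

(* Connected, and still connected when the vertex of any dart [z] is deleted
   together with the edges incident to it.  Loops and parallel edges are
   allowed, and no minimal number of vertices is imposed. *)
Definition two_connected : Prop :=
  connected_map /\
  forall z x y, ~ same_vertex z x -> ~ same_vertex z y ->
    linked [set d | ~ same_vertex z d /\ ~ same_vertex z (opp M d)] x y.

Lemma dual_rotK : cancel turn (fun x => opp M (rot M x)).
Proof. by move=> x; rewrite /turn unrotK oppK. Qed.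

Lemma dual_unrotK : cancel (fun x => opp M (rot M x)) turn.
Proof. by move=> x; rewrite /turn oppK rotK. Qed.

(* The dart [x] of the dual map crosses [x] from its left to its right. *)
Definition dual : cmap D :=
  CMap dual_rotK dual_unrotK (@oppK _ M) (@opp_neq _ M).

(* Medial map.  The corner between the consecutive darts [x] and [rot x] gives
   an edge of the medial map joining the edge of [x] to the edge of [rot x].
   Its darts are [(x, true)], which starts at (the midpoint of) the edge of [x],
   and [(x, false)], which starts at the edge of [rot x].  With [x] drawn
   eastwards, the four darts at the midpoint of [x] are, counterclockwise from
   the north-west: [(x, true)], [(unrot x, false)], [(opp x, true)] and
   [(unrot (opp x), false)]. *)
Definition medial_rot (a : D * bool) : D * bool :=
  if a.2 then (unrot M a.1, false) else (opp M (rot M a.1), true).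

Definition medial_unrot (a : D * bool) : D * bool :=
  if a.2 then (unrot M (opp M a.1), false) else (rot M a.1, true).

Definition medial_opp (a : D * bool) : D * bool := (a.1, ~~ a.2).

Lemma medial_rotK : cancel medial_rot medial_unrot.
Proof.
by case=> x [] /=; rewrite /medial_rot /medial_unrot /= ?unrotK ?oppK ?rotK.
Qed.

Lemma medial_unrotK : cancel medial_unrot medial_rot.
Proof.
by case=> x [] /=; rewrite /medial_rot /medial_unrot /= ?unrotK ?oppK ?rotK.
Qed.

Lemma medial_oppK : involutive medial_opp.
Proof. by case=> x b; rewrite /medial_opp /= negbK. Qed.

Lemma medial_opp_neq a : medial_opp a <> a.
Proof. by case: a => x [] []. Qed.

Definition medial : cmap (D * bool) :=
  CMap medial_rotK medial_unrotK medial_oppK medial_opp_neq.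

End Maps.

Definition same_face (D : Type) (M : cmap D) : D -> D -> Prop :=
  same_vertex (dual M).

(** * Maps with an action of [Z^2] and their quotients *)

Definition Z2 : zmodType := (int * int)%type.

Record lattice_map (E : Type) := LatticeMap {
  lmap :> cmap E;
  act : Z2 -> E -> E;
  act0 : forall x, act 0 x = x;
  actD : forall k l x, act (k + l) x = act k (act l x);
  act_rot : forall k x, act k (rot lmap x) = rot lmap (act k x);
  act_opp : forall k x, act k (opp lmap x) = opp lmap (act k x) }.

Section LatticeMaps.
Variables (E : Type) (M : lattice_map E).

Lemma act_unrot k x : act M k (unrot M x) = unrot M (act M k x).
Proof. by rewrite -[RHS](f_equal _ (f_equal _ (unrotK M x))) act_rot rotK. Qed.

Definition ldual : lattice_map E.
Proof.
exists (dual M) (act M).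
- exact: act0.
- exact: actD.
- by move=> k x /=; rewrite /turn act_unrot act_opp.
- exact: act_opp.
Defined.

Definition medial_act (k : Z2) (a : E * bool) : E * bool := (act M k a.1, a.2).

Definition lmedial : lattice_map (E * bool).
Proof.
exists (medial M) medial_act.
- by case=> x b; rewrite /medial_act act0.
- by move=> k l [x b]; rewrite /medial_act actD.
- by move=> k [x []] /=;
    rewrite /medial_act /medial_rot /= ?act_opp ?act_rot ?act_unrot.
- by [].
Defined.

End LatticeMaps.

Record is_quotient (E : Type) (D : finType)
    (M : lattice_map E) (G : cmap D) (p : E -> D) : Prop := IsQuotient {
  quo_surj : forall d, exists x, p x = d;
  quo_orbit : forall x y, p x = p y <-> exists k, y = act M k x;
  quo_rot : forall x, p (rot M x) = rot G (p x);
  quo_opp : forall x, p (opp M x) = opp G (p x) }.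

Lemma is_quotient_medial (E : Type) (D : finType)
    (M : lattice_map E) (G : cmap D) (p : E -> D) :
  is_quotient M G p ->
  is_quotient (lmedial M) (medial G) (fun a : E * bool => (p a.1, a.2)).
Proof.
case=> psurj porb prot popp.
have punrot x : p (unrot M x) = unrot G (p x).
  by rewrite -[in RHS](unrotK M x) prot rotK.
split.
- by case=> d b; have [x <-] := psurj d; exists (x, b).
- move=> [x b] [y c]; split=> /=.
    by case=> /porb[k ->] ->; exists k.
  by case=> k [-> ->]; congr pair; apply/porb; exists k.
- by case=> x [] /=; rewrite /medial_rot /= ?punrot ?popp ?prot.
- by [].
Qed.

(** * Planar lattice graphs *)

Section Drawings.
Variables (R : realType) (E : Type).

Definition plane : Type := (R * R)%type.

(* [arc d x] parametrizes the dart [x] by [0, 1], and [side d x] is the face of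
   the plane on the left of [x]. *)
Record drawing := Drawing {
  arc : E -> R -> plane;
  side : E -> set plane }.

Definition edge (d : drawing) (x : E) : set plane := arc d x @` `[0, 1].

Definition support (d : drawing) : set plane := \bigcup_(x in setT) edge d x.

Definition plane_faces (d : drawing) : set (set plane) :=
  [set connected_component (~` support d) q | q in ~` support d].

Definition vec (u v : plane) (k : Z2) : plane :=
  k.1%:~R *: u + k.2%:~R *: v.

Definition translate (w : plane) (U : set plane) : set plane :=
  [set q + w | q in U].

(* [d] embeds [M] in the plane as a graph invariant under the lattice spanned
   by [u] and [v], the faces traced by [M] being the faces of the drawing.
   For a 2-connected graph, [M] is determined by [d] up to a global reflection,
   which affects neither face degrees nor the underlying medial graph. *)
Record planar_lattice_graph (u v : plane) (M : lattice_map E) (d : drawing)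
    : Prop := PlanarLatticeGraph {
  plg_basis : u.1 * v.2 - u.2 * v.1 != 0;
  plg_connected : connected_map M;
  plg_locally_finite : forall x, finite_set [set y | same_vertex M x y];
  plg_continuous : forall x, {within `[0, 1], continuous (arc d x)};
  plg_opp : forall x t, t \in `[0, 1] -> arc d (opp M x) t = arc d x (1 - t);
  plg_vertex : forall x y, arc d x 0 = arc d y 0 <-> same_vertex M x y;
  plg_simple : forall x y s t, s \in `]0, 1[ -> t \in `[0, 1] ->
    arc d x s = arc d y t -> (y = x /\ t = s) \/ (y = opp M x /\ t = 1 - s);
  plg_act : forall k x t, t \in `[0, 1] ->
    arc d (act M k x) t = arc d x t + vec u v k;
  plg_side_act : forall k x,
    side d (act M k x) = translate (vec u v k) (side d x);
  plg_faces : range (side d) = plane_faces d;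
  plg_face : forall x y, side d x = side d y <-> same_face M x y;
  plg_boundary : forall x,
    closure (side d x) `\` interior (side d x) =
    \bigcup_(y in same_face M x) edge d y }.

Definition open_disk : set plane := [set q | q.1 ^+ 2 + q.2 ^+ 2 < 1].

Definition is_disk (U : set plane) : Prop :=
  exists f g : plane -> plane,
    [/\ {within U, continuous f}, {within open_disk, continuous g},
        forall q, U q -> open_disk (f q) /\ g (f q) = q &
        forall q, open_disk q -> U (g q) /\ f (g q) = q].

(* The images of the faces in the torus are disks: since a disk in the torus
   lifts homeomorphically to the plane, this says that each face in the plane is
   a disk disjoint from its translates. *)
Definition disk_faces (M : lattice_map E) (d : drawing) : Prop :=
  forall x, is_disk (side d x) /\
    forall k, k != 0 -> side d x `&` side d (act M k x) = set0.

(* The vertices of the dual drawing lie in the faces of the primal one, and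
   each edge meets its dual edge exactly once and no other dual edge. *)
Definition dual_drawing (M : lattice_map E) (d d' : drawing) : Prop :=
  [/\ forall x, side d x (arc d' x 0),
      forall x, exists q, edge d x `&` edge d' x = [set q] &
      forall x y, y <> x -> y <> opp M x -> edge d x `&` edge d' y = set0].

End Drawings.

(** * Spanning tree entropy *)

Section SpanningTrees.
Variables (E : choiceType).

(* A finite subgraph is given by the finite set [X] of the darts of [M] that
   start at its vertices; its edges are the edges of [M] with both ends in
   these vertices, i.e. [X] is understood to induce a subgraph. *)

Section Subgraph.
Variables (M : cmap E) (X : {fset E}).

Definition sub_darts : {fset E} := [fset x in X | opp M x \in X]%fset.

Definition sub_connected : Prop :=
  forall x y, x \in X -> y \in X -> linked M [set` sub_darts] x y.

Definition sub_vertices : {fset {fset E}} :=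
  [fset [fset y in X | `[< same_vertex M x y >]]%fset | x in X]%fset.

(* A set of edges is represented by the set [T] of its darts; acyclicity says
   that no edge of [T] has its ends joined by the other edges of [T]. *)
Definition spanning_tree (T : {fset E}) : Prop :=
  [/\ (T `<=` sub_darts)%fset,
      forall x, x \in T -> opp M x \in T,
      forall x y, x \in X -> y \in X -> linked M [set` T] x y &
      forall x, x \in T ->
        ~ linked M ([set` T] `\` [set x; opp M x]) x (opp M x)].

Definition tau : nat :=
  #|` [fset T in fpowerset X | `[< spanning_tree T >]]%fset |.

End Subgraph.

Variable M : lattice_map E.

(* The [n] integers from [- n./2] to [n - n./2 - 1]: these intervals are nested
   and exhaust the integers. *)
Definition window (n : nat) : seq int :=
  [seq i%:Z - (n./2)%:Z | i <- iota 0 n].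

Definition box (n : nat) : seq Z2 :=
  [seq (i, j) | i <- window n, j <- window n].

Definition copies (F : {fset E}) (n : nat) : {fset E} :=
  [fset act M k x | k in box n, x in F]%fset.

(* [F] consists of the darts starting at a set of vertices that represents each
   orbit of vertices once. *)
Definition fundamental_domain (F : {fset E}) : Prop :=
  [/\ forall x, x \in F -> rot M x \in F,
      forall x, exists! k, act M k x \in F &
      forall n, (0 < n)%N -> sub_connected M (copies F n)].

Definition entropy (R : realType) (F : {fset E}) : R :=
  limn (fun n : nat => ln ((tau M (copies F n))%:R : R) /
                       #|` sub_vertices M (copies F n)|%:R).

End SpanningTrees.

(** * Bipyramid volumes *)

Section Volumes.
Variable R : realType.

Definition lobachevsky (theta : R) : R :=
  - \int[lebesgue_measure]_(t in `[0, theta]) ln `|2 * sin t|.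

Definition vol_bipyramid (n : nat) : R :=
  2 * n%:R * lobachevsky (pi / n%:R).

Variables (D : finType) (G : cmap D).

Definition orbits (f : D -> D) : {set {set D}} :=
  [set [set y | fconnect f x y] | x : D]%SET.

Definition vertices : {set {set D}} := orbits (rot G).

Definition faces : {set {set D}} := orbits (turn G).

Definition vol : R := \sum_(f in faces) vol_bipyramid #|f|.

End Volumes.

Definition nu (R : realType) (D : finType) (G : cmap D) : R :=
  (vol R G + vol R (dual G)) / #|vertices G|%:R.

(* Main.v *)
(** Write [V] for the number of vertices of [G].  The faces of the medial map
    are those of [G] together with one triangle per vertex, and its 3V/2 vertices
    have degree 4, so [nu (medial G) = 2/3 nu G + vol_bipyramid 4] without any use
    of Euler's formula.  On the other side, subdividing the edges of a cubic graph
    with [V] vertices and [e] edges and applying star-triangle moves multiplies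
    the number of spanning trees by about [2^(e-V) 3^(e-V)], i.e. [6^(V/2)], which
    gives [z' >= 2/3 z + (ln 6)/3]; the converse inequality is not needed.  The
    theorem follows from [vol_bipyramid 4 = 3.66... < 2 pi (ln 6) / 3 = 3.75...].

    The limits defining the entropies exist because the number of maximal
    forests of induced subgraphs is supermultiplicative for disjoint unions:
    a maximal forest of a subgraph extends to a maximal forest of the whole graph,
    from which it is recovered by restriction.  The same extension argument
    compares boxes of the two lattices that are tiled by different fundamental
    domains. *)

Require Import Defs.
From Stdlib Require Import Relation_Operators.
From mathcomp Require Import all_boot all_order all_algebra finmap.
From mathcomp Require Import all_classical all_reals all_analysis.
From mathcomp Require Import measurable_realfun zify ring lra.
Import Order.TTheory GRing.Theory Num.Theory numFieldNormedType.Exports.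

Set Implicit Arguments.
Unset Strict Implicit.
Unset Printing Implicit Defensive.

Local Open Scope ring_scope.

(* [Defs.rot] and [Defs.opp] are shadowed by [seq.rot] and [GRing.opp]. *)
Local Notation rot := Defs.rot.
Local Notation opp := Defs.opp.

(** * Linked darts and acyclic edge sets *)

(** The factor comes from following one spanning tree, with [V - 1] of the [e] edges. After
    subdivision each of the [e - V + 1] other edges keeps one of its two halves. The star-triangle
    move is then a relation and not a function: a vertex with three half-edges allows three pairs of
    corners, while a vertex with a single half-edge keeps no corner and forgets which of the three
    it was. The numbers of these two kinds of vertices vary with the tree, but there are [e + V - 1]
    half-edges in all, so their difference is always [e - V - 1]; whence [2^(e-V+1) 3^(e-V-1)]. To
    obtain a single injection, the loss at the lone vertices is repaid by recording one dart at
    every vertex, [3^V] choices in all, the dart being free wherever the vertex is not lone. The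
    final margin is between two and three percent, so elementary bounds on [pi], on logarithms and
    on the Lobachevsky integral suffice, provided that they are not crude. *)

Section Linked.
Local Open Scope classical_set_scope.
Variables (D : Type) (M : cmap D).
Implicit Types (T U H : set D) (x y p q : D).

Lemma linked_refl T x : linked M T x x.
Proof. exact: rst_refl. Qed.

Lemma linked_sym T x y : linked M T x y -> linked M T y x.
Proof. exact: rst_sym. Qed.

Lemma linked_trans T x y z : linked M T x y -> linked M T y z -> linked M T x z.
Proof. exact: rst_trans. Qed.

Lemma linked_rot T x : linked M T x (rot M x).
Proof. by apply: rst_step; left. Qed.

Lemma linked_opp T x : T x -> linked M T x (opp M x).
Proof. by move=> Tx; apply: rst_step; right. Qed.

Lemma linked_sub T (P : D -> D -> Prop) :
  (forall x, P x x) -> (forall x y, P x y -> P y x) ->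
  (forall x y z, P x y -> P y z -> P x z) ->
  (forall x, P x (rot M x)) -> (forall x, T x -> P x (opp M x)) ->
  forall x y, linked M T x y -> P x y.
Proof.
move=> Pr Ps Pt Protx Popp x y; elim=> {x y}.
- by move=> x y [->|[Tx ->]]; [exact: Protx | exact: Popp].
- exact: Pr.
- by move=> x y _; exact: Ps.
- by move=> x y z _ + _; exact: Pt.
Qed.

Lemma linked_bind T U : (forall x, T x -> linked M U x (opp M x)) ->
  forall x y, linked M T x y -> linked M U x y.
Proof.
move=> TU; apply: linked_sub => //.
- exact: linked_refl.
- exact: linked_sym.
- exact: linked_trans.
- exact: linked_rot.
Qed.

Lemma linked_mono T U x y : T `<=` U -> linked M T x y -> linked M U x y.
Proof. by move=> TU; apply: linked_bind => z /TU; exact: linked_opp. Qed.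

(** Used to refute connections: exhibit a set that no step crosses and that contains exactly one of
    the two darts. *)
Lemma linked_inv T (P : D -> Prop) :
  (forall x, P x <-> P (rot M x)) -> (forall x, T x -> (P x <-> P (opp M x))) ->
  forall x y, linked M T x y -> (P x <-> P y).
Proof. by move=> Pr Po; apply: linked_sub => // [x y ->|x y z -> ->]. Qed.

Definition dart_pair x : set D := [set x; opp M x].

Definition opp_closed T := forall x, T x -> T (opp M x).

(** A loop violates this, its two darts being already joined by [rot]. *)
Definition acyclic T :=
  forall x, T x -> ~ linked M (T `\` dart_pair x) x (opp M x).

(** Spanning in the sense of the graphic matroid: no edge of [H] joins two components of [T].
    Connectedness of [H] is not implied. *)
Definition spanned T H := forall x, H x -> linked M T x (opp M x).

(** A walk can be shortened until it crosses the added edge at most once; the last two cases are the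
    two directions of crossing. *)
Lemma linked_setU_pair T d p q : linked M (T `|` dart_pair d) p q ->
  [\/ linked M T p q,
      linked M T p d /\ linked M T (opp M d) q |
      linked M T p (opp M d) /\ linked M T d q].
Proof.
pose L := linked M T.
have Lt a b c : L a b -> L b c -> L a c by exact: linked_trans.
have Ls a b : L a b -> L b a by exact: linked_sym.
move: p q; apply: linked_sub.
- by move=> x; constructor 1; exact: linked_refl.
- move=> x y [h|[h1 h2]|[h1 h2]]; [constructor 1|constructor 3|constructor 2].
  + exact: Ls.
  + by split; apply: Ls.
  + by split; apply: Ls.
- move=> x y z [h|[h1 h2]|[h1 h2]] [k|[k1 k2]|[k1 k2]].
  + by constructor 1; apply: Lt k.
  + by constructor 2; split=> //; apply: Lt k1.
  + by constructor 3; split=> //; apply: Lt k1.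
  + by constructor 2; split=> //; apply: Lt k.
  + constructor 2; split=> //; exact: k2.
  + by constructor 1; apply: Lt k2.
  + by constructor 3; split=> //; apply: Lt k.
  + by constructor 1; apply: Lt k2.
  + by constructor 3; split.
- by move=> x; constructor 1; exact: linked_rot.
- move=> x [Tx|[->|->]].
  + by constructor 1; exact: linked_opp.
  + by constructor 2; split; exact: linked_refl.
  + by rewrite oppK; constructor 3; split; exact: linked_refl.
Qed.

Lemma dart_pair_opp x : dart_pair (opp M x) = dart_pair x.
Proof. by rewrite /dart_pair oppK setUC. Qed.

Lemma acyclic_setU_pair T d : acyclic T -> opp_closed T ->
  ~ linked M T d (opp M d) -> acyclic (T `|` dart_pair d).
Proof.
move=> aT oT nd.
have nTd : ~ T d by move=> /linked_opp.
have nTo : ~ T (opp M d) by move=> /oT; rewrite oppK.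
have key : ~ linked M ((T `|` dart_pair d) `\` dart_pair d) d (opp M d).
  by move/(linked_mono (U := T)) => h; apply: nd; apply: h => x [[]].
move=> x [Tx|[->//|->]]; last first.
  by rewrite dart_pair_opp oppK => /linked_sym.
have -> : (T `|` dart_pair d) `\` dart_pair x
        = (T `\` dart_pair x) `|` dart_pair d.
  apply/seteqP; split=> y; first by case=> -[Ty|dy] nxy; [left|right].
  case=> [[Ty nxy]|dy]; first by split=> //; left.
  split; first by right.
  case: dy => -> [xd|xd].
  + by apply: nTd; rewrite xd.
  + by apply: nTd; rewrite xd; apply: oT.
  + by apply: nTo; rewrite xd.
  + by apply: nTo; rewrite xd; apply: oT.
have sub : T `\` dart_pair x `<=` T by move=> ? [].
case/linked_setU_pair; first exact: aT.
  case=> /(linked_mono sub) h1 /(linked_mono sub) h2; apply: nd.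
  apply: linked_trans (linked_sym h1) _; apply: linked_trans (linked_sym h2).
  exact: linked_opp.
case=> /(linked_mono sub) h1 /(linked_mono sub) h2; apply: nd.
apply: linked_trans h2 _; apply: linked_trans h1.
exact/linked_sym/linked_opp.
Qed.

(** An edge of [T] and [H] outside [U] would close a cycle of [T] with the walk of [U] that joins
    its ends. *)
Lemma acyclic_spanned_eq T U H : acyclic T -> opp_closed U -> U `<=` T ->
  U `<=` H -> spanned U H -> T `&` H = U.
Proof.
move=> aT oU UT UH sUH; apply/seteqP; split=> x; last by split; [apply: UT|apply: UH].
case=> Tx Hx; apply: contrapT => nUx; apply: (aT x Tx).
apply: linked_mono (sUH x Hx) => y Uy; split; first exact: UT.
by case=> yx; apply: nUx; rewrite -?yx // -[x](oppK M) -yx; apply: oU.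
Qed.

(** No edge of [T] leaves the vertex set [Q], so a walk that starts in [Q] only meets edges that
    belong to [U]. *)
Lemma linked_restrict (Q : D -> Prop) T U x y :
  (forall z, Q z <-> Q (rot M z)) ->
  (forall z, T z -> (Q z <-> Q (opp M z))) -> (forall z, T z -> Q z -> U z) ->
  Q x -> linked M T x y -> linked M U x y.
Proof.
move=> Qr Qo TU Qx lT.
suff [_] : (Q x <-> Q y) /\ (Q x -> linked M U x y) by exact.
move: x y lT {Qx}; apply: linked_sub.
- by move=> z; split=> // _; exact: linked_refl.
- by move=> z t [zt l]; split=> [|/zt/l/linked_sym//]; rewrite zt.
- move=> a b c [ab lab] [bc lbc]; split=> [|Qa]; first by rewrite ab.
  by apply: linked_trans (lab Qa) _; apply/lbc/ab.
- by move=> z; split=> // _; exact: linked_rot.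
- by move=> z Tz; split; [exact: Qo | move=> Qz; apply/linked_opp/TU].
Qed.

(** [T] lives on the vertices in [Q] and [U] on the others, so a cycle stays on one side. [half]
    treats one side and is applied to [Q] and to its complement. *)
Lemma acyclic_setU (Q : D -> Prop) T U : (forall z, Q z <-> Q (rot M z)) ->
  (forall z, T z -> Q z) -> (forall z, U z -> ~ Q z) ->
  opp_closed T -> opp_closed U -> acyclic T -> acyclic U -> acyclic (T `|` U).
Proof.
move=> Qr; move: T U.
suff half (P : D -> Prop) T U x : (forall z, P z <-> P (rot M z)) ->
    (forall z, T z -> P z) -> (forall z, U z -> ~ P z) ->
    opp_closed T -> opp_closed U -> acyclic T -> T x ->
    ~ linked M ((T `|` U) `\` dart_pair x) x (opp M x).
  move=> T U TQ UQ oT oU aT aU x [Tx|Ux]; first exact: (half Q).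
  rewrite setUC; apply: (half (fun z => ~ Q z)) => //.
    by move=> z; rewrite -Qr.
  by move=> z /TQ Qz; apply.
move=> Pr TP UP oT oU aT Tx lx; apply: (aT x Tx).
apply: linked_restrict Pr _ _ (TP x Tx) lx => z [].
- move=> [Tz|Uz] _; first by split=> _; apply: TP => //; apply: oT.
  by split=> h; exfalso; [apply: UP h | apply: UP h; apply: oU].
- by move=> [Tz|/UP//] nz _; split.
Qed.

End Linked.

(** * Maximal forests *)

Lemma leq_card_fset (S T : choiceType) (f : S -> T) (A : {fset S}) (B : {fset T}) :
  {in A &, injective f} -> (forall x, x \in A -> f x \in B) ->
  (#|` A| <= #|` B|)%N.
Proof.
move=> fI AB; rewrite -(card_in_imfset imfset_key fI).
by apply/fsubset_leq_card/fsubsetP => _ /imfsetP[x /= /AB ? ->].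
Qed.

Lemma cardfs_dep (S T : choiceType) (A : {fset S}) (B : S -> {fset T}) :
  #|` [fset (a, b) | a : S in A, b : T in B a]%fset| = (\sum_(a <- A) #|` B a|)%N.
Proof.
transitivity (sumn [seq size (B a) | a <- A]); last by rewrite sumnE big_map.
rewrite -(size_allpairs_dep pair).
apply/perm_size/uniq_perm => //.
  apply: allpairs_uniq_dep => //.
  by case=> a b [a' b'] _ _ /= [-> ->].
move=> u; apply/imfset2P/allpairsPdep => /= [[a aA [b bB ->]]|[a [b [aA bB ->]]]].
  by exists a, b.
by exists a => //; exists b.
Qed.

Lemma cardfsM (S T : choiceType) (A : {fset S}) (B : {fset T}) :
  #|` A `*` B|%fset = (#|` A| * #|` B|)%N.
Proof. by rewrite /fsetM cardfs_dep big_const_seq count_predT iter_addn_0 mulnC. Qed.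

Lemma leq_cardfs_dep (S T : choiceType) (A : {fset S}) (B : S -> {fset T}) m :
  (forall a, a \in A -> m <= #|` B a|)%N ->
  (#|` A| * m <= #|` [fset (a, b) | a : S in A, b : T in B a]%fset|)%N.
Proof.
move=> AB; rewrite cardfs_dep.
rewrite (_ : _ * m = \sum_(a <- A) m)%N; last first.
  by rewrite big_const_seq count_predT iter_addn_0 mulnC.
by rewrite big_seq [leqRHS]big_seq leq_sum.
Qed.

Section Bases.
Local Open Scope classical_set_scope.
Local Open Scope fset_scope.
Variables (E : choiceType) (M : cmap E).
Implicit Types (X T H K : {fset E}) (x y : E).

(** A maximal forest, that is a basis of the graphic matroid of [H]. Unlike spanning trees, bases
    exist for disconnected [H], which makes their number monotone in [H]. *)
Definition is_basis H T : Prop :=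
  [/\ T `<=` H, opp_closed M [set` T], acyclic M [set` T] &
      spanned M [set` T] [set` H]].

Definition bases H : {fset {fset E}} :=
  [fset T in fpowerset H | `[< is_basis H T >]].

Lemma basesP H T : reflect (is_basis H T) (T \in bases H).
Proof.
rewrite !inE /= fpowersetE; apply: (iffP andP) => [[_ /asboolP]//|bT].
by split; [case: bT | apply/asboolP].
Qed.

Lemma basis_extend K T : opp_closed M [set` K] -> T `<=` K ->
  opp_closed M [set` T] -> acyclic M [set` T] ->
  exists2 B, is_basis K B & T `<=` B.
Proof.
move=> oK; have [n] := ubnP (#|` K| - #|` T|)%N.
elim: n T => // n IH T ltn TK oT aT.
have [sT|nsT] := pselect (spanned M [set` T] [set` K]); first by exists T.
have [x [Kx nx]] : exists x, x \in K /\ ~ linked M [set` T] x (opp M x).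
  apply: contrapT => h; apply: nsT => x Kx; apply: contrapT => nx.
  by apply: h; exists x.
have nTx : x \notin T by apply/negP => xT; apply: nx; exact: linked_opp.
pose T' := x |` (opp M x |` T).
have T'E : [set` T'] = ([set` T] `|` dart_pair M x)%classic.
  apply/seteqP; split=> y /=; rewrite !inE.
    by move=> /or3P[/eqP ->|/eqP ->|yT]; [right; left|right; right|left].
  by case=> [-> |[->|->]]; rewrite ?eqxx ?orbT.
have [|||| B bB T'B] := IH T'.
- have T'K : T' `<=` K.
    by rewrite !fsubUset !fsub1set TK Kx andbT; apply: oK.
  have lt1 : (#|` T| < #|` T'|)%N.
    rewrite /T' cardfsU1 !inE negb_or nTx andbT; case: eqP => [xE|_].
      by case: (@opp_neq _ M x).
    by rewrite add1n ltnS; apply/fsubset_leq_card/fsubsetUr.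
  have := fsubset_leq_card T'K; move: ltn lt1; rewrite ltnS; lia.
- by rewrite !fsubUset !fsub1set TK Kx andbT; apply: oK.
- rewrite T'E => y [yT|[->|->]]; first by left; apply: oT.
    by right; right.
  by right; left; rewrite oppK.
- by rewrite T'E; apply: acyclic_setU_pair.
by exists B => //; apply: fsubset_trans T'B; rewrite /T' fsetUA; apply: fsubsetUr.
Qed.

Lemma bases_neq0 K : opp_closed M [set` K] -> (0 < #|` bases K|)%N.
Proof.
move=> oK; have [||||B bB _] := @basis_extend K fset0 => //.
by rewrite cardfs_gt0; apply/fset0Pn; exists B; apply/basesP.
Qed.

Lemma card_bases_le K : (#|` bases K| <= 2 ^ #|` K|)%N.
Proof.
rewrite -card_fpowerset; apply: fsubset_leq_card.
by apply/fsubsetP => T; rewrite !inE /= => /andP[].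
Qed.

(* A basis of [H] extends to a basis of [K], and is recovered from it by
   intersecting with [H]. *)
Lemma card_bases_mono H K : opp_closed M [set` K] -> H `<=` K ->
  (#|` bases H| <= #|` bases K|)%N.
Proof.
move=> oK HK.
have ext (T : {fset E}) : exists B : {fset E}, T \in bases H ->
    B \in bases K /\ B `&` H = T.
  have [/basesP[TH oT aT sT]|nT] := boolP (T \in bases H); last by exists T.
  have [B bB TB] := basis_extend oK (fsubset_trans TH HK) oT aT.
  exists B => _; split; first exact/basesP.
  have [_ oB aB _] := bB.
  have /seteqP[h1 h2] := acyclic_spanned_eq aB oT (fun x => fsubsetP TB x)
     (fun x => fsubsetP TH x) sT.
  apply/fsetP => x; rewrite !inE; apply/andP/idP => [[xB xH]|xT].
    exact: h1.
  by case: (h2 x xT).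
have [f fP] := choice ext.
apply: (@leq_card_fset _ _ f) => [T U /fP[_ TE] /fP[_ UE] TU|T /fP[]//].
by rewrite -TE TU UE.
Qed.

(** The union of two bases is a basis because the vertex set [P] separates them, and each is
    recovered by intersection. *)
Lemma card_bases_disjoint H K (P : E -> Prop) :
  (forall x, P x <-> P (rot M x)) ->
  (forall x, x \in H -> P x) -> (forall x, x \in K -> ~ P x) ->
  opp_closed M [set` H] -> opp_closed M [set` K] ->
  (#|` bases H| * #|` bases K| <= #|` bases (H `|` K)|)%N.
Proof.
move=> Pr PH PK oH oK.
have cat (A B : {fset E}) :
    is_basis H A -> is_basis K B -> is_basis (H `|` K) (A `|` B).
  move=> [AH oA aA sA] [BK oB aB sB].
  have E' : [set` A `|` B] = ([set` A] `|` [set` B])%classic.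
    by apply/seteqP; split=> x /=; rewrite in_fsetU; [move/orP|move=> h; apply/orP].
  split.
  - exact: fsetUSS.
  - by rewrite E' => x [xA|xB]; [left; apply: oA|right; apply: oB].
  - rewrite E'; apply: (acyclic_setU Pr) => // z.
      by move=> /(fsubsetP AH); exact: PH.
    by move=> /(fsubsetP BK); exact: PK.
  - rewrite E' => x /=; rewrite inE => /orP[/sA|/sB].
      by apply: linked_mono => z; left.
    by apply: linked_mono => z; right.
have capH (A B : {fset E}) : is_basis H A -> is_basis K B -> (A `|` B) `&` H = A.
  move=> [AH _ _ _] [BK _ _ _]; apply/fsetP => x; rewrite !inE.
  apply/andP/idP => [[/orP[//|xB] xH]|xA]; last by rewrite xA (fsubsetP AH).
  by case: (PK x (fsubsetP BK x xB) (PH x xH)).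
have capK (A B : {fset E}) : is_basis H A -> is_basis K B -> (A `|` B) `&` K = B.
  move=> [AH _ _ _] [BK _ _ _]; apply/fsetP => x; rewrite !inE.
  apply/andP/idP => [[/orP[xA|//] xK]|xB]; last by rewrite xB orbT (fsubsetP BK).
  by case: (PK x xK (PH x (fsubsetP AH x xA))).
rewrite -cardfsM; apply: (@leq_card_fset _ _ (fun a => a.1 `|` a.2)).
  move=> [A B] [A' B']; rewrite !in_fsetM /= => /andP[/basesP bA /basesP bB].
  move=> /andP[/basesP bA' /basesP bB'] ABE.
  congr (_, _); first by rewrite -(capH A B bA bB) /= ABE capH.
  by rewrite -(capK A B bA bB) /= ABE capK.
move=> [A B]; rewrite in_fsetM /= => /andP[/basesP bA /basesP bB].
by apply/basesP/cat.
Qed.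

(** In a connected subgraph, joining the ends of every edge amounts to joining all vertices. *)
Lemma tau_bases X : sub_connected M X -> tau M X = #|` bases (sub_darts M X)|.
Proof.
move=> cX; congr #|` _|; apply/fsetP => T; rewrite !inE /=.
have sE x : (x \in sub_darts M X) = (x \in X) && (opp M x \in X) by rewrite !inE.
have [TX|/negP nTX] := boolP (T \in fpowerset X); last first.
  apply/esym/negbTE/negP => /andP[]; rewrite fpowersetE => TX _; apply: nTX.
  rewrite fpowersetE; apply: fsubset_trans TX _.
  by apply/fsubsetP => x; rewrite sE => /andP[].
apply/asboolP/andP => [[h1 h2 h3 h4]|[_ /asboolP[h1 h2 h3 h4]]].
  split; first by rewrite fpowersetE.
  apply/asboolP; split=> // x /=; rewrite sE => /andP[xX oX]; exact: h3.
split=> // x y xX yX; exact: linked_bind (cX x y xX yX).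
Qed.

End Bases.

(** * Transversals of a system of blocks *)

Section Transversals.
Local Open Scope fset_scope.
Variables (E : choiceType) (k : nat) (blk : E -> {fset E}).
Implicit Types (Y U : {fset E}) (x y : E).

(** A partition of [Y] into blocks of size [k], given by the block of each element. It serves for
    edges ([k = 2]), for cubic vertices ([k = 3]) and for medial vertices ([k = 4]). *)
Definition block_system Y : Prop := forall x, x \in Y ->
  [/\ x \in blk x, #|` blk x| = k, blk x `<=` Y &
      forall y, y \in blk x -> blk y = blk x].

Definition trans Y : {fset {fset E}} :=
  [fset U in fpowerset Y | [forall x : Y, #|` U `&` blk (val x)| == 1%N]].

Lemma transP Y U :
  reflect (U `<=` Y /\ forall x, x \in Y -> #|` U `&` blk x| = 1%N) (U \in trans Y).
Proof.
rewrite !inE /= fpowersetE; apply: (iffP andP) => -[OY h]; split=> //.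
  by move=> x xY; have /forallP/(_ [` xY])/eqP := h.
by apply/forallP => x; apply/eqP/h/valP.
Qed.

Lemma block_system_sub Y (P : pred E) : block_system Y ->
  {in Y, forall x, P x -> {in blk x, forall y, P y}} ->
  block_system [fset x in Y | P x].
Proof.
move=> bY hP x; rewrite !inE /= => /andP[xY Px]; have [h1 h2 h3 h4] := bY x xY.
split=> //; apply/fsubsetP => y yx; rewrite !inE /= (fsubsetP h3) //=.
exact: hP yx.
Qed.

(** Induction on [Y]: a transversal is a transversal of what remains after removing one block,
    together with a free choice in that block. *)
Lemma card_trans Y : block_system Y -> exists m, [/\ #|` Y| = (k * m)%N,
  #|` trans Y| = (k ^ m)%N & forall U, U \in trans Y -> #|` U| = m].
Proof.
have [n] := ubnP #|` Y|; elim: n Y => // n IH Y ltYn bY.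
have [->|/fset0Pn[y yY]] := eqVneq Y fset0.
  exists 0%N; rewrite cardfs0 muln0 expn0; split=> //.
    rewrite (_ : trans fset0 = [fset fset0]) ?cardfs1 //.
    apply/fsetP => U; apply/transP/fset1P => [[]|->].
      by rewrite fsubset0 => /eqP.
    by split=> // x; rewrite inE.
  by move=> U /transP[]; rewrite fsubset0 => /eqP-> _; rewrite cardfs0.
have [yy cy sy ey] := bY y yY.
pose Y' := [fset x in Y | x \notin blk y].
have Y'E : Y' = Y `\` blk y by apply/fsetP => x; rewrite !inE andbC.
have blkC x z : x \in Y -> z \in blk x -> z \in blk y -> x \in blk y.
  move=> xY zx zy; have [xx _ _ ex] := bY x xY.
  by rewrite -(ey _ zy) (ex _ zx).
have bY' : block_system Y'.
  apply: (block_system_sub bY) => x xY nx z zx.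
  by apply: contra nx => zy; apply: blkC zy.
have cYY' : #|` Y| = (#|` Y'| + k)%N.
  by rewrite Y'E cardfsD (fsetIidPr sy) cy subnK // -cy fsubset_leq_card.
have k0 : (0 < k)%N by rewrite -cy cardfs_gt0; apply/fset0Pn; exists y.
have [||m [cY' ctY' cO]] := IH Y' => //; first by move: ltYn; rewrite ltnS; lia.
pose f (a : {fset E} * E) := a.2 |` a.1.
have disj U : U \in trans Y' -> U `&` blk y = fset0.
  move=> /transP[OY' _]; apply/fsetP => z; rewrite !inE; apply/negP => /andP[zO zy].
  by have := fsubsetP OY' z zO; rewrite Y'E inE zy.
have fI : {in trans Y' `*` blk y &, injective f}.
  move=> [U b] [U' b']; rewrite !in_fsetM /= => /andP[tO bb] /andP[tU' bb'].
  rewrite /f /= => /fsetP e; have dO := disj _ tO; have dU' := disj _ tU'.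
  have nO z : z \in blk y -> (z \in U) = false.
    by move=> zy; have /fsetP/(_ z) := dO; rewrite !inE zy andbT.
  have nU' z : z \in blk y -> (z \in U') = false.
    by move=> zy; have /fsetP/(_ z) := dU'; rewrite !inE zy andbT.
  have bE : b = b' by have := e b; rewrite !inE eqxx nU' // orbF => /esym/eqP.
  rewrite -bE in e nU' bb' *; congr (_, _); apply/fsetP => z.
  have := e z; rewrite !inE; have [->|//] := eqVneq z b.
  by rewrite nO ?nU'.
have imE : trans Y = [fset f a | a in trans Y' `*` blk y].
  apply/fsetP => U; apply/transP/imfsetP => [[OY hO]|[[U' b] /=]].
    have /cardfs1P[b Ob] : #|` U `&` blk y| == 1%N by rewrite hO.
    have [bO bb] : b \in U /\ b \in blk y.
      by apply/andP; rewrite -in_fsetI Ob inE.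
    exists (U `\` blk y, b).
      rewrite in_fsetM /= bb andbT; apply/transP; split.
        by rewrite Y'E; apply: fsetSD.
      move=> x; rewrite Y'E inE => /andP[nx xY]; rewrite -(hO x xY).
      congr #|` _|; apply/fsetP => z; rewrite !inE; 
      case zx: (z \in blk x); last by rewrite !andbF.
      by rewrite !andbT (_ : z \notin blk y) //; apply: contra nx; apply: blkC.
    apply/fsetP => z; rewrite /f !inE; have /fsetP/(_ z) := Ob; rewrite !inE.
    by case: (z \in U); case: (z \in blk y) => //= <-.
  rewrite in_fsetM /= => /andP[tU' bb ->]; have /transP[OY' hU'] := tU'.
  rewrite /f /=; split.
    rewrite fsubUset fsub1set (fsubsetP sy) //= (fsubset_trans OY') //.
    by rewrite Y'E fsubsetDl.
  move=> x xY; have [xy|nxy] := boolP (x \in blk y).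
    rewrite (ey _ xy) fsetIUl (disj U') // fsetU0 (fsetIidPl _) ?cardfs1 //.
    by rewrite fsub1set.
  rewrite fsetIUl (_ : [fset b] `&` _ = fset0) ?fset0U ?hU' // ?Y'E ?inE ?nxy //.
  apply/fsetP => z; rewrite !inE; apply/negP => /andP[/eqP -> bx].
  by move: nxy; rewrite (blkC x b).
exists m.+1; split.
- by rewrite cYY' cY' mulnS addnC.
- by rewrite imE card_in_imfset //= cardfsM ctY' cy expnS mulnC.
- move=> U; rewrite imE => /imfsetP[[U' b] /=]; rewrite in_fsetM /= => /andP[tU' bb ->].
  rewrite /f /= cardfsU1 (cO _ tU') (_ : b \notin U') //.
  by apply/negP => bU'; have /fsetP/(_ b) := disj _ tU'; rewrite !inE bU' bb.
Qed.

End Transversals.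

(** * Cubic maps *)

Section Cubic.
Local Open Scope classical_set_scope.
Local Open Scope fset_scope.
Variables (E : choiceType) (M : cmap E).
Implicit Types (X T U H K C S : {fset E}) (x y : E).
Hypothesis rot3 : forall x, rot M (rot M (rot M x)) = x.
Hypothesis rot_neq : forall x, rot M x <> x.

Definition star x : {fset E} := [fset x; rot M x; rot M (rot M x)].

Lemma starE x y :
  (y \in star x) = [|| y == x, y == rot M x | y == rot M (rot M x)].
Proof. by rewrite !inE orbA. Qed.

Lemma rot_inj : injective (rot M).
Proof. exact: (can_inj (@Defs.rotK _ M)). Qed.

Lemma rot2_neq x : rot M (rot M x) <> x.
Proof. by move=> h; apply: (@rot_neq x); rewrite -[RHS]rot3 h. Qed.

Lemma star_rot x : star (rot M x) = star x.
Proof.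
by apply/fsetP => y; rewrite !starE rot3; case: eqP; case: eqP; case: eqP.
Qed.

Lemma star_refl x : x \in star x.
Proof. by rewrite starE eqxx. Qed.

Lemma starP x y : same_vertex M x y <-> y \in star x.
Proof.
split; last first.
  have l := @linked_rot _ M set0; rewrite starE => /or3P[]/eqP ->.
  - exact: linked_refl.
  - exact: l.
  - by apply: linked_trans (l x) (l _).
move=> h; suff -> : star x = star y by exact: star_refl.
elim: h => {x y} [x y [->|[]//]||x y _ ->|x y z _ -> _ ->] //.
by rewrite star_rot.
Qed.

Lemma star_eq x y : y \in star x -> star y = star x.
Proof. by rewrite starE => /or3P[]/eqP ->; rewrite ?star_rot. Qed.

Lemma card_starI U x : #|` U `&` star x| =
  ((x \in U) + (rot M x \in U) + (rot M (rot M x) \in U))%N.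
Proof.
transitivity (size [seq y <- [:: x; rot M x; rot M (rot M x)] | y \in U]).
  apply/perm_size/uniq_perm => //.
    apply: filter_uniq; rewrite /= !inE negb_or andbT.
    apply/andP; split; last by apply/eqP/nesym/rot_neq.
    by apply/andP; split; apply/eqP/nesym; [exact: rot_neq | exact: rot2_neq].
  by move=> y; rewrite in_fsetI starE mem_filter !inE.
by rewrite /=; case: (x \in U); case: (_ \in U); case: (_ \in U).
Qed.

Lemma star_system X : (forall x, x \in X -> rot M x \in X) ->
  block_system 3 star X.
Proof.
move=> rX x xX; split; [exact: star_refl| | |exact: star_eq].
  by rewrite -[star x]fsetIid card_starI !starE !eqxx ?orbT.
apply/fsubsetP => y; rewrite starE => /or3P[]/eqP -> //; first exact: rX.
by apply/rX/rX.
Qed.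

(* Each pair of opposite darts merges at most two of the classes of vertices. *)
Lemma forest_representatives X T : (forall x, x \in X -> rot M x \in X) ->
  opp_closed M [set` T] -> exists2 P : {fset E}, P `<=` X &
   (2 * #|` X| <= 3 * (#|` T| + 2 * #|` P|))%N /\
   {in P &, forall p q, linked M [set` T] p q -> p = q}.
Proof.
move=> rX; have [n] := ubnP #|` T|; elim: n T => // n IH T ltTn oT.
have [T0|/fset0Pn[d dT]] := eqVneq T fset0.
  have [m [cX ctr ctr2]] := card_trans (star_system rX).
  have /fset0Pn[P tP] : trans star X != fset0 by rewrite -cardfs_gt0 ctr expn_gt0.
  have [PX hP] := transP _ _ _ tP.
  exists P => //; split; first by rewrite cX (ctr2 _ tP); lia.
  move=> p q pP qP lpq.
  have {lpq} sv : q \in star p.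
    by apply/starP; apply: linked_mono lpq => z; rewrite T0 /= inE.
  have /eqP/cardfs1P[b Pb] := hP p (fsubsetP PX p pP).
  have /fsetP/(_ p) := Pb; have /fsetP/(_ q) := Pb.
  by rewrite !in_fsetI !in_fset1 pP qP sv star_refl /= => /esym/eqP -> /esym/eqP ->.
pose T' := T `\` [fset d; opp M d].
have odT : opp M d \in T by apply: oT.
have c2 : #|` [fset d; opp M d]| = 2.
  by rewrite cardfs2; case: eqP => // dE; case: (@opp_neq _ M d).
have sub : [fset d; opp M d] `<=` T by rewrite fsubUset !fsub1set dT.
have cT : #|` T| = (#|` T'| + 2)%N.
  by rewrite /T' cardfsD (fsetIidPr sub) c2 subnK // -c2 fsubset_leq_card.
have T'E : ([set` T] `<=` [set` T'] `|` dart_pair M d)%classic.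
  move=> z /= zT; have [zd|nzd] := boolP (z \in [fset d; opp M d]).
    by right; move: zd; rewrite !inE => /orP[]/eqP ->; [left|right].
  by left; rewrite /= in_fsetD nzd.
have [||P PX [cP iP]] := IH T'.
- by move: ltTn; rewrite ltnS; lia.
- move=> z /=; rewrite !inE !negb_or => /andP[/andP[zd zo] zT].
  rewrite (inv_eq (@oppK _ M)) zo (inj_eq (inv_inj (@oppK _ M))) zd; exact: oT.
have [[p [pP lp]]|np] := pselect (exists p, p \in P /\ linked M [set` T'] p d).
  exists (P `\ p); first exact: fsubset_trans (fsubD1set _ _) PX.
  split.
    have := cardfsD1 p P; rewrite pP; move: cP; rewrite cT; lia.
  move=> a b; rewrite !inE => /andP[ap aP] /andP[bp bP].
  move=> lab; case: (linked_setU_pair (linked_mono T'E lab)); first exact: iP.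
    by case=> ld _; case/eqP: ap; apply: iP => //; exact: linked_trans ld (linked_sym lp).
  case=> _ ld; case/eqP: bp; apply: iP => //.
  exact: linked_trans (linked_sym ld) (linked_sym lp).
exists P => //; split; first by move: cP; rewrite cT; lia.
move=> a b aP bP lab.
case: (linked_setU_pair (linked_mono T'E lab)); first exact: iP.
  by case=> ld _; case: np; exists a.
by case=> _ ld; case: np; exists b; split=> //; exact: linked_sym.
Qed.

(** With [3V] darts in [X] and [2t] darts in [T], this reads [V <= t + 1]. *)
Lemma spanning_card X T : (forall x, x \in X -> rot M x \in X) ->
  opp_closed M [set` T] ->
  (forall x y, x \in X -> y \in X -> linked M [set` T] x y) ->
  (2 * #|` X| <= 3 * (#|` T| + 2))%N.
Proof.
move=> rX oT cT; have [P PX [cP iP]] := forest_representatives rX oT.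
suff : (#|` P| <= 1)%N by move: cP; lia.
have [->|/fset0Pn[p pP]] := eqVneq P fset0; first by rewrite cardfs0.
rewrite -(cardfs1 p); apply/fsubset_leq_card/fsubsetP => q qP; rewrite inE.
apply/eqP/iP => //; apply: cT; exact: (fsubsetP PX).
Qed.

End Cubic.

(** * Trees of the medial map *)

Section MedialBasis.
Local Open Scope classical_set_scope.
Variables (E : Type) (M : cmap E).
Implicit Types (T S C : set E) (x y z : E).

Definition medial_darts (C : set E) : set (E * bool) := [set a | C a.1].

Notation mid x := ((x, true) : E * bool).

Lemma mid_opp U x : linked (medial M) U (mid x) (mid (opp M x)).
Proof.
have l := @linked_rot _ (medial M) U.
have := linked_trans (l (x, true)) (l _).
by rewrite /= /medial_rot /= unrotK.
Qed.

Lemma mid_rot U x : linked (medial M) U (x, false) (mid (rot M x)).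
Proof.
have := @linked_rot _ (medial M) U (x, false).
rewrite /= /medial_rot /= => h; apply: linked_trans h _.
exact/linked_sym/mid_opp.
Qed.

(* [Z] is a set of edges of [M], that is of vertices of the medial map. *)
Lemma medial_cut U (Z : E -> Prop) : (forall x, Z x <-> Z (opp M x)) ->
  (forall x b, U (x, b) -> (Z x <-> Z (rot M x))) ->
  forall x, linked (medial M) U (x, true) (x, false) -> (Z x <-> Z (rot M x)).
Proof.
move=> Zo ZU x.
move/(linked_inv (P := fun a => Z (if a.2 then a.1 else rot M a.1))); apply.
- by move=> [y []] /=; rewrite ?unrotK // -Zo.
- by move=> [y []] /= /ZU ->.
Qed.

Hypothesis rot3 : forall x, rot M (rot M (rot M x)) = x.
Hypothesis rot_neq : forall x, rot M x <> x.

Variables (X T S C : set E).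
Hypothesis aT : acyclic M T.
Hypothesis cT : forall x y, X x -> X y -> linked M T x y.
Hypothesis TS : forall x, T x <-> S x /\ S (opp M x).
Hypothesis SX : forall x, S x -> X x.

(** [S] is a tree of the subdivided graph, given by half-edges, and [C] a choice of corners between
    them. A cycle through the corner [x] is excluded by a cut of the medial vertices that [x] is the
    only corner to cross. *)
Lemma medial_acyclic :
  (forall x, C x -> S x /\ S (rot M x)) ->
  (forall x, ~ [/\ C x, C (rot M x) & C (rot M (rot M x))]) ->
  acyclic (medial M) (medial_darts C).
Proof.
move=> C1 C3.
suff cut x : C x ->
    ~ linked (medial M) (medial_darts C `\` dart_pair (medial M) (x, true))
      (x, true) (x, false).
  move=> [x []] Cx; first exact: cut.
  have -> : (x, false) = opp (medial M) (x, true) by [].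
  by rewrite dart_pair_opp oppK => l; apply: (cut x) => //; exact: linked_sym.
move=> Cx lx; have [Sx Srx] := C1 x Cx.
(* The corner [x] joins two half-edges; one of them, [h], meets no other corner of
   [C].  Cutting [h] in the tree of half-edges yields the cut [Z]. *)
have [h [hx hC]] : exists h, (h = x \/ h = rot M x) /\
    forall y, C y -> y <> x -> y <> h /\ rot M y <> h.
  have [Crx|nCrx] := pselect (C (rot M x)).
    exists x; split; first by left.
    move=> y Cy yx; split=> // ryx; apply: (C3 x); split=> //.
    by rewrite -[in X in C X]ryx rot3.
  exists (rot M x); split; first by right.
  move=> y Cy yx; split; first by move=> yr; apply: nCrx; rewrite -yr.
  by move=> ry; apply: yx; exact: (can_inj (@Defs.rotK _ M)).
(* The vertices beyond [h]. There are none when the other half of its edge is missing, the midpoint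
   of [h] being then a leaf of the subdivided tree. *)
pose W z := S (opp M h) /\ linked M (T `\` dart_pair M h) (opp M h) z.
have Wr z : W z <-> W (rot M z).
  split=> -[Soh l]; split=> //.
    by apply: linked_trans l _; exact: linked_rot.
  by apply: linked_trans l _; apply/linked_sym; exact: linked_rot.
have Sh : S h by case: hx => ->.
have nWh : ~ W h.
  by move=> [Soh l]; apply: (aT (x := h)); [apply/TS | exact: linked_sym].
(* The midpoints beyond the cut half-edge: that of [h] itself, and those of the edges with a half in
   [S] at a vertex of [W]. By [ZW], no half-edge of [S] other than [h] crosses the cut. *)
pose Z z := [\/ z = h, z = opp M h, S z /\ W z | S (opp M z) /\ W (opp M z)].
have Zo z : Z z <-> Z (opp M z).
  have half y : Z y -> Z (opp M y).
    case=> [->|->|Wy|Wy]; [constructor 2|constructor 1|constructor 4|constructor 3] => //.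
    - by rewrite oppK.
    - by rewrite oppK.
  by split; [exact: half | move=> /half; rewrite oppK].
have ZW z : S z -> z <> h -> (Z z <-> W z).
  move=> Sz zh; split; last by move=> Wz; constructor 3.
  case=> [//|zE|[]//|[Soz Woz]].
    by rewrite zE; split; [rewrite -zE | exact: linked_refl].
  have [oh|noh] := pselect (z = opp M h).
    by rewrite oh; split; [rewrite -oh | exact: linked_refl].
  case: Woz => Soh l; split=> //; apply: linked_trans l _.
  apply/linked_sym/linked_opp; split; first exact/TS.
  by case.
have Zh : Z h by constructor 1.
suff : Z x <-> Z (rot M x).
  case: hx => hE; rewrite {}hE in Zh nWh ZW.
    by move=> [/(_ Zh) + _]; rewrite ZW // -1?Wr //; exact: rot_neq.
  move=> [_ /(_ Zh)]; rewrite ZW // 1?Wr //; exact/nesym/rot_neq.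
apply: medial_cut Zo _ _ lx => y b [/= Cy]; rewrite /dart_pair /= /medial_opp /= => nyx.
have yx : y <> x by move=> yx; apply: nyx; rewrite yx; case: (b); [left|right].
have [Sy Sry] := C1 y Cy; have [yh ryh] := hC y Cy yx.
by rewrite !ZW // -Wr.
Qed.

(** The kept corners join the midpoints of all half-edges of [S] at one vertex, tree edges carry
    this from vertex to vertex, and every edge inside [X] has a half in [S]. *)
Lemma medial_spanned : (forall x, X x <-> X (rot M x)) ->
  (forall x, S x -> S (rot M x) -> C x \/ (C (rot M x) /\ C (rot M (rot M x)))) ->
  (forall x, X x -> X (opp M x) -> S x \/ S (opp M x)) ->
  spanned (medial M) (medial_darts C)
    [set a | [/\ X a.1, X (opp M a.1) & X (opp M (rot M a.1))]].
Proof.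
move=> rX C2 Scov.
pose L x y := linked (medial M) (medial_darts C) (mid x) (mid y).
have Lt x y z : L x y -> L y z -> L x z by exact: linked_trans.
have Ls x y : L x y -> L y x by exact: linked_sym.
have Lo x : L x (opp M x) by exact: mid_opp.
have LC x : C x -> L x (rot M x).
  move=> Cx; apply: linked_trans (mid_rot _ _).
  exact: (@linked_opp _ (medial M) _ (x, true)).
have Lrot x : S x -> S (rot M x) -> L x (rot M x).
  move=> Sx Srx; have [/LC//|[/LC l1 /LC]] := C2 x Sx Srx.
  by rewrite rot3 => l2; apply/Ls/(Lt _ _ _ l1).
have Lvx x y : S x -> S y -> y = rot M x \/ y = rot M (rot M x) -> L x y.
  move=> Sx Sy [yE|yE]; rewrite yE in Sy *; first exact: Lrot.
  by apply/Ls; rewrite -[X in L _ X]rot3; apply: Lrot; rewrite ?rot3.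
pose V x y := [\/ y = x, y = rot M x | y = rot M (rot M x)].
have Vr x y : V (rot M x) y <-> V x y.
  rewrite /V rot3; split=> -[]->; by [constructor 1|constructor 2|constructor 3].
(* The midpoints reached from some half-edge of [S] at the vertex of [x]. This set is unchanged
   along the edges of [T], which is how connectedness is transferred. *)
pose K x z := exists y, [/\ V x y, S y & L y z].
have Vxx x : V x x by constructor 1.
have KE x z : S x -> (K x z <-> L x z).
  move=> Sx; split; last by move=> l; exists x.
  case=> y [vxy Sy l]; apply: Lt l; case: vxy Sy => [->|->|->] Sy.
  - exact: linked_refl.
  - by apply: Lvx => //; left.
  - by apply: Lvx => //; right.
have lK x y z : linked M T x y -> (K x z <-> K y z).
  move=> l; move: z.
  apply: (linked_sub (P := fun x y => forall z, K x z <-> K y z)) l.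
  - by [].
  - by move=> a b ab z; rewrite ab.
  - by move=> a b c ab bc z; rewrite ab.
  - by move=> a z; split=> -[b [/Vr vb Sb lb]]; exists b; split=> //; apply/Vr.
  - move=> a Ta z; have [Sa Soa] := (TS a).1 Ta.
    rewrite !KE //; split; last exact: Lt.
    by apply: Lt; apply: Ls.
have Lconn x y : X x -> X (opp M x) -> X y -> X (opp M y) -> L x y.
  have half a b : S a -> S b -> L a b.
    by move=> Sa Sb; apply/KE => //; rewrite (lK a b) ?KE;
      [exact: linked_refl | | apply: cT; exact: SX].
  move=> Xx Xox Xy Xoy.
  case: (Scov x Xx Xox) => Sx; case: (Scov y Xy Xoy) => Sy.
  - exact: half.
  - exact: Lt (half _ _ Sx Sy) (Ls _ _ (Lo y)).
  - exact: Lt (Lo x) (half _ _ Sx Sy).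
  - exact: Lt (Lo x) (Lt _ _ _ (half _ _ Sx Sy) (Ls _ _ (Lo y))).
have main x : X x -> X (opp M x) -> X (opp M (rot M x)) ->
    linked (medial M) (medial_darts C) (x, true) (x, false).
  move=> Xx Xox Xorx; apply: linked_trans (linked_sym (mid_rot _ _)).
  by apply: Lconn => //; exact: (rX x).1.
move=> [x []] [/= Xx Xox Xorx]; first exact: main.
exact/linked_sym/main.
Qed.

End MedialBasis.

(** * Star-triangle counting *)

Lemma in_fset_sep (E : choiceType) (A : {fset E}) (P : pred E) x :
  (x \in [fset y in A | P y]%fset) = (x \in A) && P x.
Proof. by rewrite !inE. Qed.

Section StarTriangle.
Local Open Scope classical_set_scope.
Local Open Scope fset_scope.
Variables (E : choiceType) (M : cmap E).
Implicit Types (T U H K C S : {fset E}) (x y : E).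
Hypothesis rot3 : forall x, rot M (rot M (rot M x)) = x.
Hypothesis rot_neq : forall x, rot M x <> x.
Variable X : {fset E}.
Hypothesis rX : forall x, x \in X -> rot M x \in X.
Hypothesis cX : sub_connected M X.
Hypothesis X2 : forall x, x \in X -> exists2 y, y \in X & y \notin star M x.

Let S0 := sub_darts M X.

Definition opp_pair x : {fset E} := [fset x; opp M x].

Lemma opp_pair_system H : opp_closed M [set` H] -> block_system 2 opp_pair H.
Proof.
move=> oH x xH; split.
- by rewrite !inE eqxx.
- by rewrite cardfs2; case: eqP => // xE; case: (@opp_neq _ M x).
- by rewrite fsubUset !fsub1set xH; apply: oH.
- by move=> y; rewrite !inE => /orP[]/eqP -> //; rewrite /opp_pair oppK fsetUC.
Qed.

Lemma opp_closed_sub_darts : opp_closed M [set` S0].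
Proof. by move=> x /=; rewrite !inE /= oppK andbC. Qed.

Lemma sum_rot (g : E -> nat) : (\sum_(x <- X) g (rot M x) = \sum_(x <- X) g x)%N.
Proof.
rewrite -(big_map (rot M) predT g); apply: perm_big; apply: uniq_perm => //.
  by rewrite map_inj_uniq //; exact: rot_inj.
move=> x; apply/mapP/idP => [[y yX ->]|xX]; first exact: rX.
by exists (rot M (rot M x)); rewrite ?rot3 //; apply/rX/rX.
Qed.

Lemma card_fset_sum (P : pred E) :
  #|` [fset x in X | P x]| = (\sum_(x <- X) P x)%N.
Proof.
transitivity (size [seq x <- X | P x]).
  apply/perm_size/uniq_perm => //; first by rewrite filter_uniq.
  by move=> x; rewrite mem_filter !inE andbC.
by rewrite size_filter -sum1_count big_mkcond; apply: eq_bigr => x _; case: P.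
Qed.

(** [full] and [lone] collect all three darts of a vertex carrying three, respectively one,
    half-edges of [S]; both are thus unions of stars. *)
Definition full S := [fset x in X | [&& x \in S, rot M x \in S & rot M (rot M x) \in S]].
Definition lone S := [fset x in X | #|` S `&` star M x| == 1%N].

(** A vertex with [d] half-edges, [d] being 1, 2 or 3, satisfies [d + [d = 1] = 2 + [d = 3]]; this
    is summed over the darts. It determines the difference between full and lone vertices from the
    size of [S]. *)
Lemma card_halves S : S `<=` X -> (forall x, x \in X -> S `&` star M x != fset0) ->
  (3 * #|` S| + #|` lone S| = 2 * #|` X| + #|` full S|)%N.
Proof.
move=> SX S1.
have -> : #|` S| = (\sum_(x <- X) (x \in S))%N.
  rewrite -card_fset_sum; congr #|` _|; apply/fsetP => x; rewrite !inE.
  by case xS: (x \in S); rewrite ?andbF // (fsubsetP SX).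
rewrite !card_fset_sum.
rewrite (_ : 3 * _ = \sum_(x <- X) ((x \in S) + (rot M x \in S) +
    (rot M (rot M x) \in S)))%N; last first.
  rewrite !big_split /= (sum_rot (fun x => (rot M x \in S) : nat)).
  by rewrite (sum_rot (fun x => (x \in S) : nat)); lia.
rewrite (_ : 2 * _ = \sum_(x <- X) 2)%N; last first.
  by rewrite big_const_seq count_predT iter_addn_0 mulnC.
rewrite -!big_split /= big_seq [RHS]big_seq; apply: eq_bigr => x xX.
have := S1 x xX; rewrite -cardfs_gt0 card_starI //.
by case: (x \in S); case: (rot M x \in S); case: (rot M (rot M x) \in S).
Qed.

(* [S] is a spanning tree of the graph obtained by subdividing every edge once,
   given by its half-edges: both halves of the edges of [T], and the half in [U]
   of every other edge. *)
Definition halves T U S : Prop :=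
  [/\ is_basis M S0 T, U \in trans opp_pair (S0 `\` T) & S = T `|` U].

(** * Half-edges of a subdivided tree *)

Section Halves.
Variables (T U S : {fset E}).
Hypothesis hS : halves T U S.

Lemma halves_sub : S `<=` S0.
Proof.
case: hS => -[TS _ _ _] /transP[US _] ->; rewrite fsubUset TS.
by apply: fsubset_trans US _; apply: fsubsetDl.
Qed.

Lemma halves_mem x : x \in S -> x \in X /\ opp M x \in X.
Proof. by move=> /(fsubsetP halves_sub); rewrite !inE => /andP. Qed.

Lemma halves_cover x : x \in X -> opp M x \in X -> x \in S \/ opp M x \in S.
Proof.
case: hS => -[TS _ _ _] /transP[US hU] -> xX oX.
have xS : x \in S0 by rewrite !inE xX.
have [xT|xT] := boolP (x \in T); first by left; rewrite inE xT.
have /eqP/cardfs1P[b /fsetP/(_ b)] : #|` U `&` opp_pair x| = 1.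
  by apply: hU; rewrite inE xT.
rewrite !in_fsetI !inE eqxx => /andP[bU /orP[]/eqP bE]; rewrite -bE bU ?orbT.
  by left.
by right.
Qed.

Lemma halves_tree x : (x \in T) = (x \in S) && (opp M x \in S).
Proof.
case: hS => -[TS oT _ _] /transP[US hU] ->; rewrite !in_fsetU.
have [xT|xT] := boolP (x \in T).
  by rewrite (_ : opp M x \in T) //; apply: (oT x).
apply/esym/negbTE/negP => /= /andP[xU /orP[oxT|oxU]].
  by case/negP: xT; rewrite -[x](@oppK _ M); apply: (oT (opp M x)).
have := hU x (fsubsetP US x xU).
rewrite (fsetIidPr _) /opp_pair ?fsubUset ?fsub1set ?xU // cardfs2.
by case: eqP => // xE; case: (@opp_neq _ M x).
Qed.

Lemma halves_diff : S `\` T = U.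
Proof.
case: hS => -[TS oT _ _] /transP[US hU] ->; apply/fsetP => x; rewrite !inE.
have [xU|xU] := boolP (x \in U); last by rewrite orbF andNb.
by have := fsubsetP US x xU; rewrite !inE => /andP[-> _]; rewrite orbT.
Qed.

Lemma halves_linked x y : x \in X -> y \in X -> linked M [set` T] x y.
Proof.
case: hS => -[TS oT _ sT] _ _ xX yX; exact: linked_bind (cX xX yX).
Qed.

(** With no half-edge at its vertex, [x] would have no tree edge either, and its star would be a
    whole component of [T]; the second vertex given by [X2] contradicts this. *)
Lemma halves_star x : x \in X -> S `&` star M x != fset0.
Proof.
move=> xX; have [y yX /negP ny] := X2 xX; apply/eqP => S0x.
have nT z : z \in star M x -> z \notin T.
  move=> zx; rewrite halves_tree; apply/negP => /andP[zS _].
  by have /fsetP/(_ z) := S0x; rewrite in_fsetI zS zx inE.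
case: ny; case: hS => -[_ oT _ _] _ _.
suff : (x \in star M x <-> y \in star M x) by case=> + _; apply; exact: star_refl.
apply: (linked_inv (P := fun z => z \in star M x)) (halves_linked xX yX).
- move=> z; split=> h; first by rewrite -(star_eq rot3 h) -star_rot // star_refl.
  rewrite -(star_eq rot3 h) star_rot //; exact: star_refl.
- move=> z zT; split=> h; first by case/negP: (nT z h).
  by case/negP: (nT _ h); apply: (oT z).
Qed.

End Halves.

(** A corner is named by its first dart; [C] holds the omitted corners. *)
Definition corners S C := [fset x in S | (rot M x \in S) && (x \notin C)].

(** As [X] is closed under [rot], the conditions say that both edges at the corner have both ends in
    [X]. *)
Definition inner_corners : {fset E * bool} :=
  [fset a in X `*` [fset true; false] |
    (opp M a.1 \in X) && (opp M (rot M a.1) \in X)].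

Definition corner_darts C : {fset E * bool} := [fset a in inner_corners | a.1 \in C].

(** * Corners kept by the star-triangle move *)

Section Corners.
Variables (T U S K : {fset E}).
Hypotheses (hS : halves T U S) (hK : K \in trans (star M) (full S)).

Let SX : S `<=` X.
Proof. by apply/fsubsetP => x /(halves_mem hS)[]. Qed.

Lemma omitted x : x \in S -> rot M x \in S -> rot M (rot M x) \in S ->
  ((x \in K) + (rot M x \in K) + (rot M (rot M x) \in K) = 1)%N.
Proof.
move=> xS rS rrS; rewrite -card_starI //; have [_ -> //] := transP _ _ _ hK.
by rewrite !inE xS rS rrS (fsubsetP SX).
Qed.

Lemma omittedS x : x \in K ->
  [/\ x \in X, x \in S, rot M x \in S & rot M (rot M x) \in S].
Proof.
have [KS _] := transP _ _ _ hK => /(fsubsetP KS); rewrite !inE.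
by move=> /and4P[].
Qed.

Lemma corner_dartsP :
  [set` corner_darts (corners S K)] = medial_darts [set` corners S K].
Proof.
apply/seteqP; split=> -[x b]; rewrite /corner_darts /medial_darts /= !inE /=.
  by case/andP.
move=> xC; rewrite xC andbT; case/andP: xC => xS /andP[rxS _].
have [-> ->] := halves_mem hS xS; have [_ ->] := halves_mem hS rxS.
by case: b.
Qed.

Lemma corners_basis :
  is_basis (medial M) inner_corners (corner_darts (corners S K)).
Proof.
have [[TS oT aT sT] _ _] := hS.
have cT x y : [set` X] x -> [set` X] y -> linked M [set` T] x y.
  exact: (halves_linked hS).
have TSP x : [set` T] x <-> [set` S] x /\ [set` S] (opp M x).
  by rewrite /= (halves_tree hS); split=> /andP.
split.
- by apply/fsubsetP => a; rewrite !inE => /andP[].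
- by rewrite corner_dartsP => -[x b].
- rewrite corner_dartsP; apply: (medial_acyclic rot3 rot_neq aT TSP).
    by move=> x; rewrite /= !inE => /and3P[].
  move=> x; rewrite /= !inE rot3 => -[/and3P[xS rS xK] /and3P[_ rrS rK] /and3P[_ _ rrK]].
  have := omitted xS rS rrS.
  by rewrite (negbTE xK) (negbTE rK) (negbTE rrK).
- rewrite corner_dartsP => a; rewrite /= !inE => /and3P[/andP[aX _] oX orX].
  apply: (medial_spanned rot3 cT TSP (S := [set` S])) => //.
  + by move=> x /(halves_mem hS)[].
  + move=> x; split=> [/rX//|rxX]; rewrite -[x]rot3; exact/rX/rX.
  + move=> x /= xS rS; rewrite !inE rot3 xS rS /=.
    have [xK|] := boolP (x \in K); last by left.
    right; have [_ _ _ rrS] := omittedS xK; rewrite rrS /=.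
    by have := omitted xS rS rrS; rewrite xK; do 2!case: (_ \in K).
  + by move=> x /= xX oxX; apply: (halves_cover hS).
Qed.

Lemma omitted_count x :
  let full_at := [&& x \in S, rot M x \in S & rot M (rot M x) \in S] in
  ((x \in K) + (rot M x \in K) + (rot M (rot M x) \in K) = full_at)%N.
Proof.
move=> /=; have [/and3P[]|nf] := boolP [&& _, _ & _]; first exact: omitted.
have nK y : y \in star M x -> y \notin K.
  rewrite starE => /or3P[]/eqP ->; apply: contra nf => /omittedS[_];
  by rewrite ?rot3 => -> -> ->.
by rewrite !(negbTE (nK _ _)) // starE eqxx ?orbT.
Qed.

Lemma lone_rot x : (rot M x \in lone S) = (x \in lone S).
Proof.
rewrite !inE /= star_rot //; congr (_ && _); apply/idP/idP; last exact: rX.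
by move=> rxX; rewrite -[x]rot3; apply/rX/rX.
Qed.

(** Two half-edges leave one corner, and three leave two since exactly one is omitted. No vertex is
    bare by [halves_star], so having no corner characterizes the lone vertices. *)
Lemma mem_lone x : x \in X -> (x \in lone S) =
  [&& x \notin corners S K, rot M x \notin corners S K &
      rot M (rot M x) \notin corners S K].
Proof.
move=> xX; rewrite !inE xX /= card_starI // rot3.
have := halves_star hS xX; rewrite -cardfs_gt0 card_starI //.
have /= := omitted_count x.
case: (x \in S); case: (rot M x \in S); case: (rot M (rot M x) \in S);
  by case: (x \in K); case: (rot M x \in K); case: (rot M (rot M x) \in K).
Qed.

(* A lone half-edge bounds no corner, all others do. *)
Lemma mem_halves x : x \in X -> (x \in S) =
  [|| x \in corners S K, rot M (rot M x) \in corners S K | (x \in S) && (x \in lone S)].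
Proof.
move=> xX; rewrite mem_lone // !inE rot3.
have /= := omitted_count x.
case: (x \in S); case: (rot M x \in S); case: (rot M (rot M x) \in S);
  by case: (x \in K); case: (rot M x \in K); case: (rot M (rot M x) \in K).
Qed.

Lemma omitted_eq : K = full S `\` corners S K.
Proof.
apply/fsetP => x; rewrite !inE; have [xK|xK] := boolP (x \in K).
  by have [-> -> -> ->] := omittedS xK; rewrite andbF.
apply/esym/negbTE/negP => /andP[+ /and4P[_ xS rS _]].
by rewrite xS rS.
Qed.

Lemma full_system : block_system 3 (star M) (full S).
Proof.
apply: (block_system_sub (star_system rot3 rot_neq rX)) => x xX /and3P[xS rS rrS] y.
by rewrite starE => /or3P[]/eqP ->; rewrite ?rot3 ?xS ?rS ?rrS.
Qed.

End Corners.

Lemma nlone_system S : block_system 3 (star M) (X `\` lone S).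
Proof.
have -> : X `\` lone S = [fset x in X | x \notin lone S].
  by apply/fsetP => x; rewrite !inE /= andbC.
apply: (block_system_sub (star_system rot3 rot_neq rX)) => x xX nx y.
by rewrite starE => /or3P[]/eqP ->; rewrite ?lone_rot.
Qed.

Definition lone_darts S := [fset x in S | x \in lone S].

Lemma mem_lone_darts S x : (x \in lone_darts S) = (x \in S) && (x \in lone S).
Proof. by rewrite !inE. Qed.

Lemma lone_trans T U S K : halves T U S -> K \in trans (star M) (X `\` lone S) ->
  lone_darts S `|` K \in trans (star M) X.
Proof.
move=> hS /transP[KX hK].
have SX : S `<=` X by apply/fsubsetP => x /(halves_mem hS)[].
apply/transP; split.
  rewrite fsubUset; apply/andP; split.
    by apply/fsubsetP => x; rewrite !inE => /andP[/(fsubsetP SX)].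
  exact: fsubset_trans KX (fsubsetDl _ _).
move=> x xX.
have lx y : y \in star M x -> (y \in lone S) = (x \in lone S).
  by rewrite starE => /or3P[]/eqP ->; rewrite ?lone_rot.
have [xl|xl] := boolP (x \in lone S).
  transitivity #|` S `&` star M x|; last by move: xl; rewrite !inE => /andP[_ /eqP].
  congr #|` _|; apply/fsetP => y; rewrite !in_fsetI in_fsetU mem_lone_darts.
  have [yx|] := boolP (y \in star M x); last by rewrite !andbF.
  rewrite lx // xl !andbT (_ : y \in K = false) ?orbF //.
  by apply/negP => /(fsubsetP KX); rewrite in_fsetD lx // xl.
rewrite -(hK x) ?in_fsetD ?xl //.
congr #|` _|; apply/fsetP => y; rewrite !in_fsetI in_fsetU mem_lone_darts.
have [yx|] := boolP (y \in star M x); last by rewrite !andbF.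
by rewrite lx // (negbTE xl) andbF.
Qed.

(* The star-triangle move at every vertex: two half-edges of [S] are replaced by
   the corner between them, and three half-edges by two of the three corners, the
   omitted one being recorded in [K].  A lone half-edge leaves no corner; it is
   remembered in the second component of [encode], which [L] completes to a
   transversal of all the vertices, so that the target is a product. *)
Definition tree_data T : {fset {fset E} * ({fset E} * {fset E})} :=
  [fset (U, q) | U : {fset E} in trans opp_pair (S0 `\` T),
     q : ({fset E} * {fset E})%type in
       trans (star M) (full (T `|` U)) `*` trans (star M) (X `\` lone (T `|` U))].

Definition encode (u : {fset E} * ({fset E} * ({fset E} * {fset E}))) :=
  let S := u.1 `|` u.2.1 in
  (corner_darts (corners S u.2.2.1), lone_darts S `|` u.2.2.2).

(** [l] detects the lone vertices as those without corner, and only there [w.2] is consulted for the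
    half-edge. Once [S] is known, [T] consists of the edges with both halves in [S], the omitted
    corners are those missing at full vertices, and the rest of [w.2] is the free choice. *)
Definition decode (w : {fset E * bool} * {fset E}) :=
  let C x := (x, true) \in w.1 in
  let l x := [&& ~~ C x, ~~ C (rot M x) & ~~ C (rot M (rot M x))] in
  let S := [fset x in X | [|| C x, C (rot M (rot M x)) | (x \in w.2) && l x]] in
  let T := [fset x in S | opp M x \in S] in
  (T, (S `\` T, (full S `\` [fset x in S | C x], [fset x in w.2 | ~~ l x]))).

Lemma encodeK T U K L : halves T U (T `|` U) ->
  K \in trans (star M) (full (T `|` U)) ->
  L \in trans (star M) (X `\` lone (T `|` U)) ->
  decode (encode (T, (U, (K, L)))) = (T, (U, (K, L))).
Proof.
set S := T `|` U => hS hK hL.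
have SX : S `<=` X by apply/fsubsetP => x /(halves_mem hS)[].
have [LX _] := transP _ _ _ hL.
rewrite /encode /= -/S /decode /=.
have CE x : ((x, true) \in corner_darts (corners S K)) = (x \in corners S K).
  by have /seteqP[h1 h2] := corner_dartsP K hS;
     apply/idP/idP; [exact: (h1 (x, true)) | exact: (h2 (x, true))].
set S' := [fset x in X | _].
have -> : S' = S.
  apply/fsetP => x; have [xX|xX] := boolP (x \in X); last first.
    rewrite [RHS](negbTE (contra (fsubsetP SX x) xX)).
    by apply: contraNF xX; rewrite in_fset_sep => /andP[].
  rewrite [RHS](mem_halves hS hK) // in_fset_sep xX !CE -(mem_lone hS hK) //.
  congr [|| _, _ | _]; rewrite in_fsetU mem_lone_darts.
  case xl: (x \in lone S); rewrite ?andbF ?andbT //=.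
  case xL: (x \in L); rewrite ?orbF //.
  by have := fsubsetP LX x xL; rewrite in_fsetD xl.
have -> : [fset x in S | opp M x \in S] = T.
  by apply/fsetP => x; rewrite [RHS](halves_tree hS) !inE.
rewrite (halves_diff hS); congr (_, (_, (_, _))).
  rewrite [RHS](omitted_eq hK); congr (_ `\` _); apply/fsetP => x.
  by rewrite in_fset_sep CE !in_fset_sep; case: (x \in S).
apply/fsetP => x; rewrite in_fset_sep in_fsetU mem_lone_darts !CE.
have [xL|xL] := boolP (x \in L).
  have := fsubsetP LX x xL; rewrite in_fsetD => /andP[xl xX].
  by rewrite orbT -(mem_lone hS hK) // xl.
rewrite orbF; apply/negbTE/negP => /andP[/andP[xS xl]].
by rewrite -(mem_lone hS hK) ?xl // (fsubsetP SX).
Qed.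

(** For [e > 0] this is an equality when [V = t + 1]; an excess [j] of tree edges replaces a factor
    [2^j] by [3^j]. *)
Lemma tree_data_arith e V t : (t <= e)%N -> (V <= t.+1)%N ->
  (2 * 6 ^ e <= 3 * 2 ^ V * (2 ^ (e - t) * 3 ^ (e + t - V)))%N.
Proof.
(* Without edges and with [V = 1] the truncated subtraction [e + t - V] makes [nE] false, hence the
   separate case. *)
move=> te Vt; have [/andP[/eqP e0 /eqP t0]|pos] := boolP ((e == 0) && (t == 0))%N.
  by move: Vt; rewrite e0 t0; case: V => [|[|]].
pose i := (e - t)%N; pose j := (t.+1 - V)%N.
have eE : e.+1 = (V + i + j)%N by rewrite /i /j; lia.
have nE : (e + t - V).+1 = (e + j)%N.
  by move: pos te Vt; rewrite negb_and /j; lia.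
have -> : (3 * 2 ^ V * (2 ^ (e - t) * 3 ^ (e + t - V)) =
           2 ^ (V + i) * 3 ^ e * 3 ^ j)%N.
  by rewrite -[RHS]mulnA -[(3 ^ e * _)%N]expnD -nE expnS expnD -/i; ring.
have -> : (2 * 6 ^ e = 2 ^ (V + i) * 3 ^ e * 2 ^ j)%N.
  rewrite -[6%N]/(2 * 3)%N expnMn mulnA -expnS eE expnD; ring.
by rewrite leq_mul2l; apply/orP; right; case: (j) => // k; rewrite leq_exp2r.
Qed.

(** [V] and [e] count vertices and edges. A basis with [t] edges carries at least
    [2^(e-t) 3^(e+t-V)] data, and [encode] injects all of them into the pairs of a medial basis and
    a transversal of the vertices. *)
Lemma star_triangle_count : exists e V,
  [/\ #|` X| = (3 * V)%N, #|` S0| = (2 * e)%N &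
   (2 * 6 ^ e * #|` bases M S0| <=
    3 * 6 ^ V * #|` bases (medial M) inner_corners|)%N].
Proof.
have [V [cXV ctX _]] := card_trans (star_system rot3 rot_neq rX).
have [e [cS0 _ _]] := card_trans (opp_pair_system opp_closed_sub_darts).
exists e, V; split=> //.
have tree T : T \in bases M S0 -> (2 * 6 ^ e <= 3 * 2 ^ V * #|` tree_data T|)%N.
  move=> /basesP bT; have [TS oT aT sT] := bT.
  have [t [cT _ _]] := card_trans (opp_pair_system oT).
  have oST : opp_closed M [set` S0 `\` T].
    move=> x /=; rewrite !in_fsetD => /andP[xT xS].
    rewrite (opp_closed_sub_darts xS) andbT; apply: contra xT => oxT.
    by rewrite -[x](@oppK _ M); apply: (oT (opp M x)).
  have [s [cs cts cU]] := card_trans (opp_pair_system oST).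
  have sE : s = (e - t)%N.
    by move: cs; rewrite cardfsD (fsetIidPr TS) cS0 cT -mulnBr => /eqP; rewrite eqn_mul2l => /eqP.
  have te : (t <= e)%N by have := fsubset_leq_card TS; rewrite cS0 cT leq_mul2l.
  have Vt : (V <= t.+1)%N.
    have := spanning_card rot3 rot_neq rX oT
      (fun x y xX yX => linked_bind sT (cX xX yX)).
    by rewrite cXV cT; lia.
  apply: leq_trans (tree_data_arith te Vt) _.
  rewrite leq_mul2l /= -sE -cts; apply/orP; right; apply: leq_cardfs_dep => U tU.
  have hS : halves T U (T `|` U) by split.
  set S := T `|` U in hS *.
  have SX : S `<=` X by apply/fsubsetP => x /(halves_mem hS)[].
  have cS : #|` S| = (2 * t + s)%N.
    have := cardfsUI T U; rewrite -/S cT (cU _ tU) (_ : T `&` U = fset0).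
      by rewrite cardfs0 addn0.
    apply/fsetP => x; rewrite !inE; apply/negP => /andP[xT xU].
    have [/fsubsetP/(_ x xU) + _] := transP _ _ _ tU.
    by rewrite in_fsetD xT.
  have := card_halves SX (fun x => halves_star hS (x := x)).
  have [f [cf ctf _]] := card_trans (@full_system S).
  have [g [cg ctg _]] := card_trans (@nlone_system S).
  (* [f] counts full vertices and [g] those that are not lone. Each varies with [S], but
     [card_halves] fixes their sum at [e + t - V]. *)
  rewrite cardfsM ctf ctg cf cS cXV -expnD leq_exp2l //.
  have lX : lone S `<=` X by apply/fsubsetP => x; rewrite in_fset_sep => /andP[].
  have := cardfsD X (lone S); rewrite (fsetIidPr lX) cg cXV.
  by have := fsubset_leq_card lX; rewrite cXV; lia.
pose quads := [fset (T, u) | T : {fset E} in bases M S0,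
   u : ({fset E} * ({fset E} * {fset E}))%type in tree_data T].
have le_quads : (#|` quads| <= #|` bases (medial M) inner_corners| * 3 ^ V)%N.
  rewrite -ctX -cardfsM; apply: (@leq_card_fset _ _ encode).
    apply: (can_in_inj (g := decode)) => _ /imfset2P[T /= /basesP bT [u /= + ->]].
    case/imfset2P=> U /= tU [q /= + ->]; case: q => K L; rewrite in_fsetM /= => /andP[].
    by apply: encodeK; split.
  move=> _ /imfset2P[T /= /basesP bT [u /= + ->]].
  case/imfset2P=> U /= tU [q /= + ->]; case: q => K L; rewrite in_fsetM /= => /andP[hK hL].
  have hS : halves T U (T `|` U) by split.
  rewrite in_fsetM /=; apply/andP; split; last exact: lone_trans hS hL.
  exact/basesP/(corners_basis hS).
rewrite (_ : 6 ^ V = 2 ^ V * 3 ^ V)%N; last by rewrite -expnMn.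
rewrite (_ : 3 * _ * _ =
  3 * 2 ^ V * (#|` bases (medial M) inner_corners| * 3 ^ V))%N; last by ring.
apply: leq_trans (leq_mul (leqnn (3 * 2 ^ V)) le_quads).
rewrite /quads cardfs_dep big_distrr /= mulnC.
rewrite (_ : #|` bases M S0| * _ = \sum_(T <- bases M S0) 2 * 6 ^ e)%N; last first.
  by rewrite big_const_seq count_predT iter_addn_0 mulnC.
by rewrite big_seq [leqRHS]big_seq leq_sum.
Qed.

End StarTriangle.

(** * Regular maps and vertex counts *)

(** A transversal meets each block once, so its size counts the blocks. *)
Lemma card_blocks (E : choiceType) k (blk : E -> {fset E}) (Y : {fset E}) :
  block_system k blk Y -> #|` Y| = (k * #|` [fset blk x | x in Y]%fset|)%N.
Proof.
move=> bY; have [m [cY ctY cO]] := card_trans bY; rewrite cY; congr (_ * _)%N.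
have [Y0|/fset0Pn[y yY]] := eqVneq Y fset0.
  move: cO; rewrite Y0 => /(_ fset0) <-; rewrite ?cardfs0; last first.
    by apply/transP; split=> // x; rewrite inE.
  by apply/esym/eqP; rewrite cardfs_eq0; apply/eqP/fsetP => B; rewrite !inE;
    apply/negP => /imfsetP[x]; rewrite inE.
have [U tU] : exists U, U \in trans blk Y.
  apply/fset0Pn; rewrite -cardfs_gt0 ctY expn_gt0; have [yy cy _ _] := bY y yY.
  by rewrite -cy cardfs_gt0; apply/orP; left; apply/fset0Pn; exists y.
have [UY hU] := transP _ _ _ tU.
rewrite -(cO _ tU) (_ : [fset blk x | x in Y] = [fset blk x | x in U])%fset.
  rewrite card_in_imfset //= => x z xU zU xz.
  have [xx _ _ _] := bY x (fsubsetP UY x xU).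
  have [zz _ _ _] := bY z (fsubsetP UY z zU).
  have /eqP/cardfs1P[b Ub] := hU x (fsubsetP UY x xU).
  have /fsetP/(_ x) := Ub; have /fsetP/(_ z) := Ub.
  by rewrite !in_fsetI !in_fset1 xU zU xx xz zz => /esym/eqP -> /esym/eqP ->.
apply/fsetP => B; apply/imfsetP/imfsetP => /= -[x xY ->]; last first.
  by exists x => //; apply: (fsubsetP UY).
have /eqP/cardfs1P[b /fsetP/(_ b)] := hU x xY.
rewrite in_fsetI in_fset1 eqxx => /andP[bU bx].
by exists b => //; have [_ _ _ /(_ b bx)] := bY x xY.
Qed.

Lemma card_sub_vertices (E : choiceType) (M : cmap E) k (blk : E -> {fset E})
    (X : {fset E}) :
  block_system k blk X -> (forall x y, same_vertex M x y <-> y \in blk x) ->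
  #|` X| = (k * #|` sub_vertices M X|)%N.
Proof.
move=> bX sv; rewrite (card_blocks bX); congr (_ * #|` _|)%N.
apply: eq_in_imfset => //= x xX; have [_ _ sX _] := bX x xX.
apply/fsetP => y; rewrite in_fset_sep; apply/idP/andP => [yx|[_ /asboolP/sv//]].
by split; [exact: (fsubsetP sX) | apply/asboolP/sv].
Qed.

Section Regular.
Local Open Scope classical_set_scope.
Variables (E : choiceType) (M : cmap E).
Hypothesis M3 : regular M 3.

Lemma regular3_vertex x : exists A : {fset E},
  #|` A| = 3 /\ forall y, y \in A <-> same_vertex M x y.
Proof.
exists (fset_set [set y | same_vertex M x y]); split.
  exact/card_fset_set/M3.
have fin : finite_set [set y | same_vertex M x y] by exists 3; exact: M3.
by move=> y; rewrite in_fset_set // inE.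
Qed.

(** A [rot]-cycle of length one or two would already be the whole vertex, and a longer one than
    three would give it four distinct darts. *)
Lemma regular3_rot x : rot M (rot M (rot M x)) = x /\ rot M x <> x.
Proof.
have [A [cA hA]] := regular3_vertex x.
have fI : injective (rot M) := can_inj (@Defs.rotK _ M).
have sr z : same_vertex M x z -> same_vertex M x (rot M z).
  by move=> xz; apply: linked_trans xz _; exact: linked_rot.
have sx : same_vertex M x x by exact: linked_refl.
have small (s : seq E) : x \in s -> (size s < 3)%N ->
    (forall z, z \in s <-> rot M z \in s) -> False.
  move=> xs ss hs; suff : (#|` A| <= size s)%N by rewrite cA; lia.
  apply: uniq_leq_size => // z /hA h.
  have step w : set0 w -> (w \in s <-> opp M w \in s) by [].
  by have [/(_ xs)] := linked_inv hs step h.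
have n1 : rot M x <> x.
  move=> x1; apply: (small [:: x]); rewrite ?inE // => z; rewrite !inE.
  by rewrite -{2}x1 (inj_eq fI).
have n2 : rot M (rot M x) <> x.
  move=> x2; apply: (small [:: x; rot M x]); rewrite ?inE ?eqxx // => z; rewrite !inE.
  by rewrite (inj_eq fI) -{3}x2 (inj_eq fI) orbC.
split=> //; apply: contrapT => n3.
suff : (size [:: x; rot M x; rot M (rot M x); rot M (rot M (rot M x))] <= #|` A|)%N.
  by rewrite cA.
apply: uniq_leq_size; last first.
  have [s1 s2] := (sr _ sx, sr _ (sr _ sx)).
  by move=> z; rewrite !inE => /or4P[]/eqP ->; apply/hA => //; exact: sr.
rewrite /= !inE !negb_or !(inj_eq fI) !andbT.
do !(apply/andP; split); apply/eqP => h.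
- exact: n1.
- exact: n2.
- exact: n3.
- exact: n1.
- exact: n2.
- exact: n1.
Qed.

End Regular.

Section MedialStar.
Local Open Scope fset_scope.
Variables (E : choiceType) (M : cmap E).

Definition medial_star (a : E * bool) : {fset E * bool} :=
  let r := rot (medial M) in [fset a; r a; r (r a); r (r (r a))].

Lemma medial_rot4 a : let r := rot (medial M) in r (r (r (r a))) = a.
Proof. by case: a => x [] /=; rewrite /medial_rot /= ?unrotK ?oppK ?Defs.rotK ?unrotK ?oppK. Qed.

Lemma medial_star_rot a : medial_star (rot (medial M) a) = medial_star a.
Proof.
have := medial_rot4 a; rewrite /medial_star /= => ->.
by apply/fsetP => y; rewrite !inE; do 4!case: eqP.
Qed.

Lemma medial_star_refl a : a \in medial_star a.
Proof. by rewrite !inE eqxx. Qed.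

Lemma medial_starP a b : same_vertex (medial M) a b <-> b \in medial_star a.
Proof.
split; last first.
  have l := @linked_rot _ (medial M) set0.
  rewrite !inE -!orbA => /or4P[]/eqP ->.
  - exact: linked_refl.
  - exact: l.
  - exact: linked_trans (l a) (l _).
  - exact: linked_trans (linked_trans (l a) (l _)) (l _).
move=> h; suff -> : medial_star a = medial_star b by exact: medial_star_refl.
elim: h => {a b} [x y [->|[]//]||x y _ ->|x y z _ -> _ ->] //.
by rewrite medial_star_rot.
Qed.

Lemma medial_rot2_neq a : a != rot (medial M) (rot (medial M) a).
Proof.
rewrite eq_sym; apply/eqP; case: a => x [] /= [].
  by rewrite unrotK => xE; case: (@opp_neq _ M x).
by move=> h; apply: (@opp_neq _ M (rot M x)); rewrite -[LHS](@unrotK _ M) h.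
Qed.

Lemma medial_star_system (X : {fset E * bool}) :
  (forall a, a \in X -> rot (medial M) a \in X) -> block_system 4 medial_star X.
Proof.
move=> rX a aX; split; first exact: medial_star_refl.
- transitivity (size [:: a; rot (medial M) a; rot (medial M) (rot (medial M) a);
      rot (medial M) (rot (medial M) (rot (medial M) a))]) => //.
  apply/perm_size/uniq_perm => //; last by move=> b; rewrite !inE -!orbA.
  have fl b : b != rot (medial M) b by apply/eqP; case: b => x [] [].
  have f3 b : b != rot (medial M) (rot (medial M) (rot (medial M) b)).
    by apply/eqP; case: b => x [] [].
  have rI : injective (rot (medial M)) := can_inj (@Defs.rotK _ (medial M)).
  rewrite /= !inE !negb_or !(inj_eq rI) !fl f3 !andbT /=.
  by rewrite !medial_rot2_neq.
- apply/fsubsetP => b; rewrite !inE -!orbA => /or4P[]/eqP -> //.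
  + exact: rX.
  + exact/rX/rX.
  + exact/rX/rX/rX.
- move=> b; rewrite !inE -!orbA => /or4P[]/eqP -> //; by rewrite !medial_star_rot.
Qed.

End MedialStar.

(** * Translates of a fundamental domain *)

Definition boxes (n : nat) : {fset Z2} := [fset k in box n]%fset.

Lemma mem_window n (z : int) :
  (z \in window n) = (- (n./2)%:Z <= z < n%:Z - (n./2)%:Z).
Proof.
apply/mapP/idP => [[i]|].
  rewrite mem_iota => /andP[_ hi] ->; lia.
move=> h; exists (absz (z + (n./2)%:Z)); last by lia.
by rewrite mem_iota; lia.
Qed.

Lemma mem_boxes n (k : Z2) :
  (k \in boxes n) = (k.1 \in window n) && (k.2 \in window n).
Proof.
rewrite !inE /=; apply/allpairsP/andP => [[[i j] [? ? ->]] //|[h1 h2]].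
by exists (k.1, k.2); split=> //; case: (k).
Qed.

Lemma uniq_window n : uniq (window n).
Proof. by rewrite map_inj_uniq ?iota_uniq // => i j /addIr[]. Qed.

Lemma card_boxes n : #|` boxes n| = (n ^ 2)%N.
Proof.
transitivity (size (box n)); last first.
  by rewrite size_allpairs !size_map size_iota mulnn.
apply/perm_size/uniq_perm => //.
  by apply: allpairs_uniq; rewrite ?uniq_window // => -[? ?] [? ?].
by move=> k; rewrite !inE.
Qed.

Definition near_cells (r : nat) (k l : Z2) : bool :=
  (`|k.1 - l.1| <= r%:Z) && (`|k.2 - l.2| <= r%:Z).

Lemma near_boxes r n (k l : Z2) :
  near_cells r k l -> l \in boxes n -> k \in boxes (n + r.*2).
Proof.
rewrite /near_cells !mem_boxes !mem_window => /andP[h1 h2] /andP[h3 h4].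
by apply/andP; split; lia.
Qed.

Section Regions.
Local Open Scope classical_set_scope.
Local Open Scope fset_scope.
Local Open Scope ring_scope.
Variables (E : choiceType) (M : lattice_map E) (F : {fset E}).

Definition region (K : {fset Z2}) : {fset E} :=
  [fset act M k x | k in K, x in F].

Lemma copies_region n : copies M F n = region (boxes n).
Proof.
apply/fsetP => x; apply/imfset2P/imfset2P => -[k kn [y yF ->]];
  by exists k; [move: kn; rewrite !inE | exists y].
Qed.

(* [c x] is the translate of [F] that contains [x]. *)
Definition is_cell (c : E -> Z2) : Prop :=
  [/\ forall k x, c (act M k x) = k + c x, forall x, c (rot M x) = c x &
      forall x, (c x == 0) = (x \in F)].

Lemma actK k : cancel (act M k) (act M (- k)).
Proof. by move=> x; rewrite -actD addNr act0. Qed.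

Lemma actNK k : cancel (act M (- k)) (act M k).
Proof. by move=> x; rewrite -actD subrr act0. Qed.

Lemma exists_cell : fundamental_domain M F -> exists c, is_cell c.
Proof.
case=> rF uF _.
have ex (x : E) : exists k : Z2, act M (- k) x \in F.
  by have [k [kF _]] := uF x; exists (- k); rewrite opprK.
have [c hc] := choice ex.
have cE x k : act M k x \in F -> c x = - k.
  have [l [_ lF]] := uF x; move=> /lF <-.
  by rewrite (lF _ (hc x)) opprK.
exists c; split.
- move=> k x; rewrite (cE _ (- c x - k)); first by rewrite opprB opprK addrC.
  by rewrite actD actK.
- by move=> x; rewrite (cE _ (- c x)) ?opprK // act_rot; exact: rF.
- move=> x; apply/eqP/idP => [c0|xF]; first by have := hc x; rewrite c0 oppr0 act0.
  by rewrite (cE x 0) ?oppr0 ?act0.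
Qed.

Variable c : E -> Z2.
Hypothesis hc : is_cell c.

Lemma mem_region K x : (x \in region K) = (c x \in K).
Proof.
have [cD _ c0] := hc; apply/imfset2P/idP => /= [[k kK [y yF ->]]|cK].
  by move: yF; rewrite cD -c0 => /eqP ->; rewrite addr0.
exists (c x) => //; exists (act M (- c x) x); last by rewrite actNK.
by rewrite -c0 cD addNr.
Qed.

Lemma region_rot K x : x \in region K -> rot M x \in region K.
Proof. by rewrite !mem_region; have [_ -> _] := hc. Qed.

Lemma card_region K : #|` region K| = (#|` K| * #|` F|)%N.
Proof.
have [cD _ c0] := hc; rewrite -cardfsM.
rewrite (_ : region K = [fset act M a.1 a.2 | a in K `*` F]).
  rewrite card_in_imfset //= => -[k x] [l y]; rewrite !in_fsetM /= -!c0.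
  move=> /andP[_ /eqP x0] /andP[_ /eqP y0] e.
  have kl : k = l by have := congr1 c e; rewrite !cD x0 y0 !addr0.
  by rewrite -kl in e *; congr (_, _); apply: (can_inj (actK k)).
apply/fsetP => x; apply/imfset2P/imfsetP => /= [[k kK [y yF ->]]|[[k y]]].
  by exists (k, y) => //; rewrite in_fsetM /= kK.
by rewrite in_fsetM /= => /andP[kK yF] ->; exists k => //; exists y.
Qed.

(** The difference of [h] and [c] is invariant under translations, so it is bounded by its values on
    the finite set [F]. *)
Lemma bounded_displacement (h : E -> Z2) :
  (forall k x, h (act M k x) = k + h x) ->
  exists r, forall x, near_cells r (h x) (c x).
Proof.
have [cD _ c0] := hc; move=> hD.
have [r hr] : exists r, forall x, x \in F -> near_cells r (h x) 0.
  pose b x := (`|(h x).1| + `|(h x).2|)%N.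
  exists (\sum_(x <- F) b x)%N => x xF.
  have : (b x <= \sum_(x <- F) b x)%N by rewrite (big_fsetD1 x) //= leq_addr.
  by rewrite /near_cells /b; case: (h x) => i j /=; lia.
exists r => x.
have := hr (act M (- c x) x); rewrite -c0 cD addNr eqxx hD => /(_ isT).
rewrite /near_cells; case: (h x) (c x) => [i j] [i' j'] /=.
by rewrite !subr0 ![- _ + _]addrC.
Qed.

Definition forests K := #|` bases M (sub_darts M (region K))|.

Lemma mem_sub_darts X x : (x \in sub_darts M X) = (x \in X) && (opp M x \in X).
Proof. by rewrite in_fset_sep. Qed.

Lemma sub_dartsS X Y : X `<=` Y -> sub_darts M X `<=` sub_darts M Y.
Proof.
move=> /fsubsetP XY; apply/fsubsetP => x.
by rewrite !mem_sub_darts => /andP[/XY -> /XY ->].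
Qed.

Lemma regionS K K' : K `<=` K' -> region K `<=` region K'.
Proof. by move=> /fsubsetP KK; apply/fsubsetP => x; rewrite !mem_region => /KK. Qed.

Lemma forests_gt0 K : (0 < forests K)%N.
Proof. by apply: bases_neq0; exact: opp_closed_sub_darts. Qed.

Lemma forests_le K : (forests K <= 2 ^ (#|` K| * #|` F|))%N.
Proof.
apply: leq_trans (card_bases_le _ _) _; rewrite leq_exp2l // -card_region.
by apply/fsubset_leq_card/fsubsetP => x; rewrite mem_sub_darts => /andP[].
Qed.

Lemma forestsU K K' : [disjoint K & K'] ->
  (forests K * forests K' <= forests (K `|` K'))%N.
Proof.
move=> /fdisjointP dK; have [_ cr _] := hc.
have sub : sub_darts M (region K) `|` sub_darts M (region K') `<=`
    sub_darts M (region (K `|` K')).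
  rewrite fsubUset; apply/andP; split; apply/sub_dartsS/regionS.
    exact: fsubsetUl.
  exact: fsubsetUr.
apply: leq_trans (card_bases_mono (@opp_closed_sub_darts _ M _) sub).
apply: (card_bases_disjoint (P := fun x => c x \in K)).
- by move=> x; rewrite cr.
- by move=> x; rewrite mem_sub_darts mem_region => /andP[].
- move=> x; rewrite mem_sub_darts mem_region => /andP[cK' _] cK.
  by have := dK _ cK; rewrite cK'.
- exact: opp_closed_sub_darts.
- exact: opp_closed_sub_darts.
Qed.

Lemma linked_act l (T U : set E) x y : (forall z, T z -> U (act M l z)) ->
  linked M T x y -> linked M U (act M l x) (act M l y).
Proof.
move=> TU; apply: (linked_sub (P := fun x y => linked M U (act M l x) (act M l y))).
- by move=> z; exact: linked_refl.
- by move=> z w; exact: linked_sym.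
- by move=> a b d; exact: linked_trans.
- by move=> z; rewrite act_rot; exact: linked_rot.
- by move=> z Tz; rewrite act_opp; apply/linked_opp/TU.
Qed.

Lemma forests_shift l K : (forests K <= forests [fset (k + l)%R | k in K])%N.
Proof.
have [cD _ _] := hc.
pose f (T : {fset E}) := [fset act M l x | x in T].
have fE T x : (x \in f T) = (act M (- l) x \in T).
  by rewrite -{1}[x](actNK l) mem_imfset //=; exact: can_inj (actK l).
have fI : injective f.
  by move=> T U /fsetP TU; apply/fsetP => x; have := TU (act M l x); rewrite !fE actK.
apply: (@leq_card_fset _ _ f); first by move=> T U _ _; exact: fI.
move=> T /basesP[TS oT aT sT]; apply/basesP.
have SE x : (x \in sub_darts M (region [fset (k + l)%R | k in K])) =
            (act M (- l) x \in sub_darts M (region K)).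
  have mK k : (k \in [fset (k + l)%R | k in K]) = (- l + k \in K).
    apply/imfsetP/idP => /= [[k' kK ->]|kK]; first by rewrite addrC addrK.
    by exists (- l + k) => //; rewrite addrC addrA subrr add0r.
  by rewrite !mem_sub_darts !mem_region !mK -!cD -act_opp.
split.
- by apply/fsubsetP => x; rewrite fE SE; apply/fsubsetP.
- by move=> x; rewrite /= !fE act_opp => h; exact: (oT (act M (- l) x)).
- move=> x; rewrite /= fE => xT lx; apply: (aT (act M (- l) x) xT).
  rewrite -act_opp; apply: linked_act lx => z [/=]; rewrite fE => zT nz.
  split=> //= -[zE|zE]; apply: nz; [left|right].
    by apply: (can_inj (actK (- l))).
  by apply: (can_inj (actK (- l))); rewrite zE act_opp.
- move=> x; rewrite /= SE => xS; have := sT (act M (- l) x) xS.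
  rewrite -act_opp => /(linked_act (l := l) (U := [set` f T])).
  by rewrite !actNK; apply => z zT; rewrite /= fE actK.
Qed.

End Regions.

(** * Superadditive functions of finite subsets of the square lattice *)

Section Superadditive.
Local Open Scope fset_scope.
Local Open Scope ring_scope.
Variables (R : realType) (g : {fset Z2} -> R) (B : R).
Hypothesis g_ge0 : forall K, 0 <= g K.
Hypothesis g_le : forall K, g K <= B * #|` K|%:R.
Hypothesis gU : forall K K', [disjoint K & K'] -> g K + g K' <= g (K `|` K').
Hypothesis g_shift : forall (l : Z2) K, g K <= g [fset (k + l)%R | k in K].

Lemma superadditive_mono K K' : K `<=` K' -> g K <= g K'.
Proof.
move=> KK'; have -> : K' = K `|` (K' `\` K).
  by apply/fsetP => x; rewrite !inE; case xK: (x \in K) => //=; rewrite (fsubsetP KK').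
apply: le_trans (gU _).
  by rewrite lerDl.
by apply/fdisjointP => x xK; rewrite !inE xK.
Qed.

Lemma superadditive_shifts K (s : seq Z2) : uniq s ->
  (forall l l' k k', l \in s -> l' \in s -> k \in K -> k' \in K ->
     k + l = k' + l' -> l = l') ->
  (size s)%:R * g K <= g [fset (k + l)%R | k in K, l in s].
Proof.
elim: s => [|l s IH] /=; first by rewrite mul0r.
move=> /andP[ls us] sI.
have -> : [fset (k + l)%R | k in K, l in l :: s] =
    [fset (k + l)%R | k in K] `|` [fset (k + l)%R | k in K, l in s].
  apply/fsetP => x; rewrite in_fsetU; apply/imfset2P/orP => /=.
    move=> [k kK [l' + ->]]; rewrite inE => /orP[/eqP ->|l's].
      by left; apply/imfsetP; exists k.
    by right; apply/imfset2P; exists k => //; exists l'.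
  move=> [/imfsetP[k /= kK ->]|/imfset2P[k /= kK [l' /= l's ->]]].
    by exists k => //; exists l; rewrite ?inE ?eqxx.
  by exists k => //; exists l'; rewrite ?inE ?l's ?orbT.
apply: le_trans (gU _).
  rewrite -natr1 addrC mulrDl mul1r lerD //.
  apply: IH => // a b k k' as' bs; apply: sI; by rewrite inE ?as' ?bs orbT.
apply/fdisjointP => _ /imfsetP[k /= kK ->]; apply/negP => /imfset2P[k' /= k'K [l' /= l's]].
move=> /sI ll'; case/negP: ls; rewrite (ll') ?inE ?eqxx ?l's ?orbT //.
Qed.

Lemma superadditive_boxes m n q : (0 < m)%N -> (q * m <= n)%N ->
  (q ^ 2)%:R * g (boxes m) <= g (boxes n).
Proof.
move=> m0 qmn.
(* The offset that moves the left end of [window m] to that of [window n], followed by [i] steps of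
   length [m]: [q ^ 2] disjoint boxes of side [m] then fit into the box of side [n]. *)
pose t (i : nat) : int := (m./2)%:Z - (n./2)%:Z + (i * m)%:Z.
pose s : seq Z2 := [seq (t i, t j) | i <- iota 0 q, j <- iota 0 q].
have tI i j (a b : int) : a \in window m -> b \in window m -> a + t i = b + t j -> i = j.
  rewrite !mem_window /t => ha hb e.
  have {}e : a + (i * m)%:Z = b + (j * m)%:Z by lia.
  have [ij|ij|//] := ltngtP i j; exfalso.
    have : ((i.+1) * m <= j * m)%N by rewrite leq_mul2r ij orbT.
    rewrite mulSn; lia.
  have : ((j.+1) * m <= i * m)%N by rewrite leq_mul2r ij orbT.
  rewrite mulSn; lia.
have w0 : 0 \in window m by rewrite mem_window; lia.
have us : uniq s.
  apply: allpairs_uniq; rewrite ?iota_uniq // => -[i j] [i' j'] _ _ /= [e1 e2].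
  by congr (_, _); apply: (tI _ _ 0 0 w0 w0); rewrite !add0r.
have sz : size s = (q ^ 2)%N by rewrite size_allpairs size_iota mulnn.
rewrite -sz; apply: le_trans (superadditive_shifts us _) _.
  move=> l l' [a b] [a' b'] /allpairsP[[i j] /= [_ _ ->]] /allpairsP[[i' j'] /= [_ _ ->]].
  rewrite !mem_boxes /= => /andP[ha hb] /andP[ha' hb'] [e1 e2].
  have -> := tI _ _ _ _ ha ha' e1.
  by have -> := tI _ _ _ _ hb hb' e2.
apply: superadditive_mono; apply/fsubsetP => x /imfset2P[[a b] /= + [l /= + ->]].
rewrite !mem_boxes !mem_window /= => /andP[ha hb] /allpairsP[[i j] /= [+ + ->]].
rewrite !mem_iota !add0n /= => hi hj; rewrite /t /=.
have bnd k : (k < q)%N -> (k * m + m <= n)%N.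
  by move=> kq; rewrite addnC -mulSn (leq_trans _ qmn) // leq_mul2r kq orbT.
have := bnd i hi; have := bnd j hj.
by move=> h1 h2; apply/andP; split; lia.
Qed.

(** A two-dimensional form of Fekete's lemma: [L] is the supremum of the normalized values, so the
    upper bound holds for every [n] with no error term. *)
Lemma superadditive_limit : exists L : R,
  (forall n, g (boxes n) <= L * n%:R ^+ 2) /\
  (forall eps, 0 < eps -> exists N, forall n, (N <= n)%N ->
      (L - eps) * n%:R ^+ 2 <= g (boxes n)).
Proof.
pose a n := g (boxes n) / n%:R ^+ 2.
pose A := [set x | exists2 n, (0 < n)%N & x = a n]%classic.
have supA : has_sup A.
  split; first by exists (a 1); exists 1.
  exists B => _ [n n0 ->]; rewrite ler_pdivrMr ?exprn_gt0 ?ltr0n //.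
  by have := g_le (boxes n); rewrite card_boxes natrX.
exists (sup A); split.
  case=> [|n].
    have := g_le (boxes 0); rewrite card_boxes /= !mulr0 => h.
    by rewrite expr0n mulr0.
  rewrite -ler_pdivrMr ?exprn_gt0 ?ltr0n //.
  by apply: ub_le_sup; [case: supA | exists n.+1].
move=> eps e0.
have e2 : 0 < eps / 2 by rewrite divr_gt0.
have [_ [m m0 ->] ham] := sup_adherent e2 supA.
have a0 : 0 <= a m by rewrite divr_ge0 ?exprn_ge0.
have mR : 0 < m%:R :> R by rewrite ltr0n.
(* Tiling loses at most [2 m n] of the area [n ^ 2]; beyond this threshold the loss times [a m] is
   at most [n ^ 2 * eps / 2]. *)
exists (maxn m (Num.bound (4 * m%:R * a m / eps))) => n.
rewrite geq_max => /andP[mn].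
rewrite -(ler_nat R) => /(lt_le_trans (archi_boundP _)) nb.
have {nb} : 4 * m%:R * a m < n%:R * eps.
  by rewrite -ltr_pdivrMr // nb // divr_ge0 ?mulr_ge0 // ltW.
have := superadditive_boxes m0 (leq_trunc_div n m).
have -> : g (boxes m) = a m * m%:R ^+ 2 by rewrite /a mulfVK // expf_neq0 // gt_eqF.
have : n%:R - m%:R <= (n %/ m)%:R * m%:R :> R.
  by rewrite lerBlDr -natrM -natrD ler_nat {1}(divn_eq n m) leq_add2l ltnW // ltn_pmod.
rewrite natrX; have : m%:R <= n%:R :> R by rewrite ler_nat.
move: (n%:R) (n %/ m)%:R (a m) a0 ham => x q b b0 ham mx qm gq h.
apply: le_trans gq.
have {}qm : (x - m%:R) ^+ 2 <= (q * m%:R) ^+ 2.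
  by rewrite lerXn2r ?nnegrE ?subr_ge0 // (le_trans _ qm) ?subr_ge0.
have x0 : 0 <= x by apply: le_trans mx; exact: ltW.
apply: (@le_trans _ _ ((x - m%:R) ^+ 2 * b)); last first.
  rewrite mulrCA -exprMn mulrC; exact: ler_wpM2l.
have h1 : 0 <= m%:R ^+ 2 * b by rewrite mulr_ge0 // exprn_ge0 // ltW.
have h2 : 0 <= (b - (sup A - eps / 2)) * x ^+ 2.
  by rewrite mulr_ge0 ?exprn_ge0 // subr_ge0 ltW.
have h3 : 0 <= (x * eps - 4 * m%:R * b) * x by rewrite mulr_ge0 // subr_ge0 ltW.
by nra.
Qed.

End Superadditive.

(** * Entropy *)

Section Entropy.
Local Open Scope classical_set_scope.
Local Open Scope fset_scope.
Local Open Scope ring_scope.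
Variables (R : realType) (E : choiceType) (M : lattice_map E) (F : {fset E}).
Variable c : E -> Z2.
Hypothesis hc : is_cell M F c.

Lemma forests_limit : exists L : R,
  (forall n, ln (forests M F (boxes n))%:R <= L * n%:R ^+ 2) /\
  (forall eps, 0 < eps -> exists N, forall n, (N <= n)%N ->
      (L - eps) * n%:R ^+ 2 <= ln (forests M F (boxes n))%:R :> R).
Proof.
have f0 K : (0 : R) < (forests M F K)%:R by rewrite ltr0n; exact: forests_gt0.
apply: (@superadditive_limit R (fun K => ln (forests M F K)%:R) (#|` F|%:R * ln 2)).
- by move=> K; apply: ln_ge0; rewrite ler1n; exact: forests_gt0.
- move=> K; rewrite mulrAC -natrM mulnC mulr_natl -lnXn // ler_ln ?posrE ?exprn_gt0 //.
  by rewrite -natrX ler_nat; exact: forests_le hc K.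
- move=> K K' dK; rewrite -lnM ?posrE // ler_ln ?posrE ?mulr_gt0 // -natrM ler_nat.
  exact: forestsU hc _ _ dK.
- by move=> l K; rewrite ler_ln ?posrE // ler_nat; exact: forests_shift hc l K.
Qed.

(** With [k] darts at each vertex, the box of side [n] has [n ^ 2 * #|F| / k] vertices. *)
Lemma entropy_eq (k : nat) (L : R) : (0 < k)%N -> (0 < #|` F|)%N ->
  fundamental_domain M F ->
  (forall n, #|` region M F (boxes n)| =
     (k * #|` sub_vertices M (region M F (boxes n))|)%N) ->
  (forall n, ln (forests M F (boxes n))%:R <= L * n%:R ^+ 2) ->
  (forall eps, 0 < eps -> exists N, forall n, (N <= n)%N ->
      (L - eps) * n%:R ^+ 2 <= ln (forests M F (boxes n))%:R :> R) ->
  entropy M R F = k%:R * L / #|` F|%:R.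
Proof.
move=> k0 F0 [_ _ cF] hV hL1 hL2; apply/cvg_lim => //.
have kR : (0 : R) < k%:R by rewrite ltr0n.
have FR : (0 : R) < #|` F|%:R by rewrite ltr0n.
apply/cvgrPdist_le => e e0.
have [|N hN] := hL2 (e * (#|` F|%:R / k%:R)); first by rewrite mulr_gt0 ?divr_gt0.
exists (maxn N 1) => // n /=; rewrite geq_max => /andP[Nn n1].
have cX : #|` sub_vertices M (copies M F n)|%:R = n%:R ^+ 2 * (#|` F|%:R / k%:R) :> R.
  apply: (mulfI (x := k%:R)); first by rewrite gt_eqF.
  rewrite -natrM copies_region -hV (card_region hc) card_boxes natrM natrX.
  by rewrite mulrCA [k%:R * _]mulrC divfK ?gt_eqF.
suff : `|k%:R * L / #|` F|%:R - ln (forests M F (boxes n))%:R /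
    (n%:R ^+ 2 * (#|` F|%:R / k%:R))| <= e :> R.
  by rewrite -cX /forests -copies_region -tau_bases //; exact: cF.
have nR : (0 : R) < n%:R ^+ 2 by rewrite exprn_gt0 // ltr0n.
have := hL1 n; have := hN n Nn; move: (ln _) => w.
set f : R := #|` F|%:R / k%:R.
have f0 : 0 < f by rewrite divr_gt0.
have -> : k%:R * L / #|` F|%:R = L / f by rewrite /f invf_div mulrA [L * _]mulrC.
move: (n%:R ^+ 2) nR => t t0 h1 h2.
have -> : L / f - w / (t * f) = (L * t - w) / (t * f).
  by field; rewrite !gt_eqF.
rewrite ger0_norm; last by rewrite divr_ge0 ?subr_ge0 // ltW // mulr_gt0.
rewrite ler_pdivrMr ?mulr_gt0 ?invr_gt0 //; move: h1.
by rewrite mulrBl lerBlDr lerBlDl -mulrA [f * t]mulrC.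
Qed.

Lemma card_fundamental (D : finType) (G : cmap D) (p : E -> D) :
  is_quotient M G p -> #|` F| = #|D|.
Proof.
have [cD _ c0] := hc; case=> psurj porb _ _.
have pI : {in F &, injective p}.
  move=> x y; rewrite -!c0 => /eqP xF /eqP yF /porb[k yE].
  have := congr1 c yE; rewrite cD xF yF addr0 => k0.
  by rewrite yE -k0 act0.
rewrite -(card_in_imfset imfset_key pI) cardE; apply/perm_size/uniq_perm.
- exact: fset_uniq.
- exact: enum_uniq.
move=> d; rewrite mem_enum; apply/imfsetP; have [x <-] := psurj d.
exists (act M (- c x) x); first by rewrite /= -c0 cD addNr.
by apply/porb; exists (- c x).
Qed.

End Entropy.

(** * Comparison of the two entropies *)

Lemma ln_nat_le (R : realType) (e V u w : nat) : (0 < u)%N -> (0 < w)%N ->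
  (2 * 6 ^ e * u <= 3 * 6 ^ V * w)%N ->
  e%:R * ln 6 + ln u%:R <= ln 3 + V%:R * ln 6 + ln w%:R :> R.
Proof.
move=> u0 w0 le; have uR : (0 : R) < u%:R by rewrite ltr0n.
have wR : (0 : R) < w%:R by rewrite ltr0n.
have p6 n : (0 : R) < 6 ^+ n by rewrite exprn_gt0.
have le' : 6 ^+ e * u%:R <= 3 * 6 ^+ V * w%:R :> R.
  by rewrite -!natrX -!natrM ler_nat; apply: leq_trans le; rewrite -mulnA leq_pmull.
rewrite !mulr_natl -!lnXn // -!lnM ?posrE //; try exact: mulr_gt0.
by rewrite ler_ln ?posrE //; do ?apply: mulr_gt0.
Qed.

Section MedialEntropy.
Local Open Scope classical_set_scope.
Local Open Scope fset_scope.
Local Open Scope ring_scope.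
Variables (E : choiceType) (M : lattice_map E) (F : {fset E}) (F' : {fset (E * bool)}).
Hypothesis M3 : regular M 3.
Hypothesis hF : fundamental_domain M F.
Variables (c : E -> Z2) (c' : E * bool -> Z2).
Hypothesis hc : is_cell M F c.
Hypothesis hc' : is_cell (lmedial M) F' c'.

Let rot3 x : rot M (rot M (rot M x)) = x. Proof. by case: (regular3_rot M3 x). Qed.
Let rot_neq x : rot M x <> x. Proof. by case: (regular3_rot M3 x). Qed.

Lemma near_cellsW r r' k l : (r <= r')%N -> near_cells r k l -> near_cells r' k l.
Proof. by rewrite /near_cells => rr /andP[h1 h2]; apply/andP; split; lia. Qed.

Lemma common_displacement : exists r, forall x,
  [/\ near_cells r (c (opp M x)) (c x) & forall b, near_cells r (c' (x, b)) (c x)].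
Proof.
have [cD _ _] := hc; have [cD' _ _] := hc'.
have [r1 h1] : exists r, forall x, near_cells r (c (opp M x)) (c x).
  by apply: (bounded_displacement hc) => k x; rewrite -act_opp cD.
have bd b : exists r, forall x, near_cells r (c' (x, b)) (c x).
  by apply: (bounded_displacement hc) => k x; rewrite -cD'.
have [r2 h2] := bd true; have [r3 h3] := bd false.
exists (r1 + r2 + r3)%N => x; split.
  by apply: near_cellsW (h1 x); lia.
by case; [apply: near_cellsW (h2 x) | apply: near_cellsW (h3 x)]; lia.
Qed.

(** The count is made on the box of side [n + 2r]. Every edge at the box of side [n] lies inside it,
    which bounds [e] below, and its inner corners lie in the medial box of side [n + 4r]. *)
Lemma forests_medial_ge : exists r, forall n, (2 <= n)%N -> exists e V,
  [/\ (n ^ 2 * #|` F| <= 2 * e)%N,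
      ((n + r.*2) ^ 2 * #|` F| = 3 * V)%N &
      (2 * 6 ^ e * forests M F (boxes n) <=
       3 * 6 ^ V * forests (lmedial M) F' (boxes (n + r.*2 + r.*2)))%N].
Proof.
have [r hr] := common_displacement; exists r => n n2.
have near0 k : near_cells r k k by rewrite /near_cells !subrr normr0.
pose X := region M F (boxes (n + r.*2)).
have rX x : x \in X -> rot M x \in X by exact: region_rot hc _ _.
have cX : sub_connected M X.
  by rewrite /X -copies_region; case: hF => _ _; apply; rewrite addn_gt0 (ltnW n2).
have cdX : #|` X| = ((n + r.*2) ^ 2 * #|` F|)%N by rewrite (card_region hc) card_boxes.
have X2 x : x \in X -> exists2 y, y \in X & y \notin star M x.
  move=> xX; apply: contrapT => nex.
  have : X `<=` star M x.
    by apply/fsubsetP => y yX; apply: contrapT => /negP yx; apply: nex; exists y.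
  move=> /fsubset_leq_card; have [_ -> _ _] := star_system rot3 rot_neq rX xX.
  have : (0 < #|` X|)%N by rewrite cardfs_gt0; apply/fset0Pn; exists x.
  rewrite cdX muln_gt0 => /andP[_ F0].
  have : (2 ^ 2 * 1 <= (n + r.*2) ^ 2 * #|` F|)%N.
    by rewrite leq_mul // leq_exp2r //; lia.
  lia.
have [e [V [cV cS0 le]]] := star_triangle_count rot3 rot_neq rX cX X2.
have sub0 : region M F (boxes n) `<=` sub_darts M X.
  apply/fsubsetP => x; rewrite (mem_region hc) mem_sub_darts !(mem_region hc) => xn.
  by rewrite (near_boxes _ xn) // (near_boxes _ xn) //; case: (hr x).
have le0 : (forests M F (boxes n) <= #|` bases M (sub_darts M X)|)%N.
  apply: card_bases_mono; first exact: opp_closed_sub_darts.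
  apply: fsubset_trans sub0; apply/fsubsetP => x.
  by rewrite mem_sub_darts => /andP[].
have le1 : (#|` bases (medial M) (inner_corners M X)| <=
    forests (lmedial M) F' (boxes (n + r.*2 + r.*2)))%N.
  apply: card_bases_mono; first exact: opp_closed_sub_darts.
  apply/fsubsetP => -[x b]; rewrite in_fset_sep in_fsetM => /andP[/andP[/= xX _] _].
  rewrite (@mem_sub_darts _ (lmedial M)) !(mem_region hc'); move: xX; rewrite (mem_region hc) => xX.
  have [_ hx] := hr x.
  by apply/andP; split; apply: near_boxes xX; exact: hx.
exists e, V; split.
- by rewrite -cS0 -card_boxes -(card_region hc) fsubset_leq_card.
- by rewrite -cdX.
- exact: leq_trans (leq_mul (leqnn _) le0) (leq_trans le (leq_mul (leqnn _) le1)).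
Qed.

(** Up to terms linear in [n], the exponent [e - V] is at least [n ^ 2 * #|F| * (1/2 - 1/3)], whence
    the sixth. *)
Lemma medial_limit_ge (R : realType) (L L' : R) :
  (forall eps, 0 < eps -> exists N, forall n, (N <= n)%N ->
      (L - eps) * n%:R ^+ 2 <= ln (forests M F (boxes n))%:R :> R) ->
  (forall n, ln (forests (lmedial M) F' (boxes n))%:R <= L' * n%:R ^+ 2) ->
  L + #|` F|%:R / 6 * ln 6 <= L'.
Proof.
move=> hL hL'; rewrite leNgt; apply/negP => lt.
have [r hr] := forests_medial_ge.
set f : R := #|` F|%:R in lt *; set a : R := ln 6 in lt *.
pose eps := (L + f / 6 * a - L') / 2.
have eps0 : 0 < eps by rewrite divr_gt0 // subr_gt0.
have [N hN] := hL eps eps0.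
have a0 : 0 <= a by apply: ln_ge0; rewrite ler1n.
have f0 : 0 <= f by rewrite ler0n.
have L'0 : 0 <= L'.
  have := hL' 1; rewrite expr1n mulr1; apply: le_trans; apply: ln_ge0.
  by rewrite ler1n; exact: forests_gt0.
(* The error terms come from expanding [(n + 4r) ^ 2] and [(n + 2r) ^ 2]. They are linear in [n] and
   cannot dominate [eps * n ^ 2]. *)
have key n : (N <= n)%N -> (2 <= n)%N ->
    eps * n%:R ^+ 2 <= ln 3 + L' * (8 * r%:R * n%:R + 16 * r%:R ^+ 2)
      + f * a / 3 * (4 * r%:R * n%:R + 4 * r%:R ^+ 2).
  move=> Nn n2; have [e [V [he hV le]]] := hr n n2.
  have := hN n Nn; have := hL' (n + r.*2 + r.*2)%N.
  have : e%:R * a + ln (forests M F (boxes n))%:R <=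
     ln 3 + V%:R * a + ln (forests (lmedial M) F' (boxes (n + r.*2 + r.*2)))%:R :> R.
    by apply: ln_nat_le le; exact: forests_gt0.
  have : n%:R ^+ 2 * f <= 2 * e%:R :> R by rewrite -natrX -!natrM ler_nat.
  have : (n%:R + 2 * r%:R) ^+ 2 * f = 3 * V%:R :> R.
    transitivity ((3 * V)%N%:R : R); last by rewrite natrM.
    by rewrite -hV natrM natrX natrD -mul2n natrM.
  have -> : (n + r.*2 + r.*2)%:R = n%:R + 4 * r%:R :> R.
    by rewrite -addnA natrD -mul2n -mulnDr !natrM; ring.
  move: (n%:R) (r%:R) (e%:R) (V%:R) (ln _%:R) (ln _%:R) => x y p q w w' h1 h2 h3 h4 h5.
  have h6 : 0 <= (2 * p - x ^+ 2 * f) * a by rewrite mulr_ge0 // subr_ge0.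
  have h7 : (x + 2 * y) ^+ 2 * f * a = 3 * q * a by rewrite h1.
  by rewrite /eps in h5 *; nra.
set A := L' * (8 * r%:R) + f * a / 3 * (4 * r%:R).
set B := ln 3 + L' * (16 * r%:R ^+ 2) + f * a / 3 * (4 * r%:R ^+ 2).
have A0 : 0 <= A by rewrite addr_ge0 // !mulr_ge0 // invr_ge0.
have B0 : 0 <= B.
  by rewrite !addr_ge0 ?mulr_ge0 ?exprn_ge0 ?invr_ge0 //; apply: ln_ge0; rewrite ler1n.
pose n := maxn (maxn N 2) (Num.bound ((A + B) / eps)).
have AB0 : 0 <= (A + B) / eps by apply: divr_ge0; [exact: addr_ge0 | exact: ltW].
have n2 : (2 <= n)%N by rewrite /n; lia.
have Nn : (N <= n)%N by rewrite /n; lia.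
have := key n Nn n2.
have : (A + B) / eps < n%:R.
  by apply: lt_le_trans (archi_boundP AB0) _; rewrite ler_nat /n; lia.
rewrite ltr_pdivrMr //.
have : 1 <= n%:R :> R by rewrite ler1n; lia.
move: (n%:R) => x x1 h1 h2.
have h3 : 0 < (x * eps - (A + B)) * x by rewrite mulr_gt0 ?subr_gt0 // (lt_le_trans _ x1).
have h4 : 0 <= B * (x - 1) by rewrite mulr_ge0 ?subr_ge0.
by rewrite /A /B in h3 h4; nra.
Qed.

End MedialEntropy.

(** * Volumes *)

(** Spreads the value of an orbit evenly over its elements. Sums over faces become sums over darts,
    which split along the boolean component of medial darts. *)
Lemma sum_orbits (R : numFieldType) (D : finType) (f : D -> D) (phi : nat -> R) :
  injective f ->
  \sum_(A in orbits f) phi #|A| = \sum_x phi (order f x) / (order f x)%:R.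
Proof.
move=> fI; pose h x := [set y | fconnect f x y]%SET.
have hE x y : (h x == h y) = (x \in h y).
  rewrite inE; apply/eqP/idP => [e|yx].
    have : x \in h x by rewrite inE connect0.
    by rewrite e inE.
  apply/setP => z; rewrite !inE.
  by rewrite (same_connect (fconnect_sym fI) yx).
rewrite [RHS](partition_big_imset h) /=; apply: eq_bigr => _ /imsetP[x _ ->].
transitivity (\sum_(i in h x) phi #|h x| / #|h x|%:R); last first.
  apply: eq_big => [i|i ix]; first by rewrite hE.
  have e y : order f y = #|h y| by apply: eq_card => z; rewrite !inE.
  by move: ix; rewrite -hE !e => /eqP ->.
rewrite sumr_const -[RHS]mulr_natr divfK // pnatr_eq0 -lt0n.
by apply/card_gt0P; exists x; rewrite inE connect0.
Qed.

Section Orders.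
Variables (D : finType) (f : D -> D).

Lemma order3 x : f (f (f x)) = x -> f x != x -> f (f x) != x -> injective f ->
  order f x = 3.
Proof.
move=> f3 f1 f2 fI; apply: (order_cycle (p := [:: x; f x; f (f x)])).
- by rewrite /= /frel /= f3 !eqxx.
- by rewrite /= !inE negb_or (inj_eq fI) ![x == _]eq_sym f1 f2.
- by rewrite inE eqxx.
Qed.

Lemma order4 x : f (f (f (f x))) = x -> f x != x -> f (f x) != x ->
  f (f (f x)) != x -> injective f -> order f x = 4.
Proof.
move=> f4 f1 f2 f3 fI; apply: (order_cycle (p := [:: x; f x; f (f x); f (f (f x))])).
- by rewrite /= /frel /= f4 !eqxx.
- by rewrite /= !inE !negb_or !(inj_eq fI) ![x == _]eq_sym f1 f2 f3.
- by rewrite inE eqxx.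
Qed.

End Orders.

Section Volumes.
Variables (R : realType) (D : finType) (G : cmap D).
Hypothesis rot3 : forall x, rot G (rot G (rot G x)) = x.
Hypothesis rot_neq : forall x, rot G x <> x.

Let beta n : R := vol_bipyramid R n / n%:R.

Lemma turn_inj (D' : finType) (G' : cmap D') : injective (turn G').
Proof. exact: can_inj (@dual_rotK _ G'). Qed.

Lemma volE (D' : finType) (G' : cmap D') :
  vol R G' = \sum_x beta (order (turn G') x).
Proof. by rewrite /vol /faces sum_orbits //; exact: turn_inj. Qed.

Lemma card_vertices (D' : finType) (G' : cmap D') k : (0 < k)%N ->
  (forall x, order (rot G') x = k) -> #|vertices G'|%:R = #|D'|%:R / k%:R :> R.
Proof.
move=> k0 ok; have rI : injective (rot G') := can_inj (@Defs.rotK _ G').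
have := sum_orbits (fun=> 1 : R) rI; rewrite sumr_const => ->.
under eq_bigr do rewrite ok div1r.
by rewrite sumr_const mulr_natl.
Qed.

Let rot_inj : injective (rot G) := can_inj (@Defs.rotK _ G).

Let rot2_neq x : rot G (rot G x) <> x.
Proof. by move=> h; apply: (@rot_neq x); rewrite -[RHS]rot3 h. Qed.

Lemma order_rot x : order (rot G) x = 3.
Proof. by apply: order3 => //; apply/eqP. Qed.

Lemma order_turn_dual x : order (turn (dual G)) x = 3.
Proof.
apply: order3; last exact: turn_inj.
- by rewrite /turn /= !oppK rot3 oppK.
- by rewrite /turn /= -{2}[x](@oppK _ G) (inj_eq (inv_inj (@oppK _ G))); apply/eqP.
- by rewrite /turn /= !oppK -{2}[x](@oppK _ G) (inj_eq (inv_inj (@oppK _ G))); apply/eqP.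
Qed.

Lemma order_rot_medial a : order (rot (medial G)) a = 4.
Proof.
apply: order4; last exact: can_inj (@Defs.rotK _ (medial G)).
- exact: medial_rot4.
- by apply/eqP; case: a => x [] [].
- by rewrite eq_sym medial_rot2_neq.
- by apply/eqP; case: a => x [] [].
Qed.

Lemma order_turn_dual_medial a : order (turn (dual (medial G))) a = 4.
Proof.
have oI : injective (opp (medial G)) := inv_inj (@oppK _ (medial G)).
have tE b : turn (dual (medial G)) b = opp (medial G) (rot (medial G) (opp (medial G) b)) by [].
apply: order4; last exact: turn_inj.
- by rewrite !tE !oppK medial_rot4 oppK.
- by rewrite tE -{2}[a](@oppK _ (medial G)) (inj_eq oI); apply/eqP; case: a => x [] [].
- rewrite !tE !oppK -{2}[a](@oppK _ (medial G)) (inj_eq oI) eq_sym.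
  exact: medial_rot2_neq.
- rewrite !tE !oppK -{2}[a](@oppK _ (medial G)) (inj_eq oI).
  by apply/eqP; case: a => x [] [].
Qed.

Lemma order_turn_medial_true x : order (turn (medial G)) (x, true) = 3.
Proof.
apply: order3; last exact: turn_inj.
- by rewrite /turn /= /medial_unrot /= rot3.
- by apply/eqP => -[]; exact: rot_neq.
- by apply/eqP => -[]; exact: rot2_neq.
Qed.

(** The medial [turn] sends [(x, false)] to [(turn G x, false)]: these darts trace the old faces,
    the darts [(x, true)] the triangles around vertices. *)
Lemma order_turn_medial_false x :
  order (turn (medial G)) (x, false) = order (turn G) x.
Proof.
rewrite -[RHS]size_orbit -(size_map (fun y => (y, false))).
apply: order_cycle.
- rewrite (mono_cycle (e := frel (turn G))); first exact/cycle_orbit/turn_inj.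
  by move=> y z /=; rewrite xpair_eqE andbT.
- by rewrite map_inj_uniq ?orbit_uniq // => y z [].
- by rewrite map_f // in_orbit.
Qed.

(** The medial triangles contribute exactly [vol R (dual G)], whose faces are triangles too, so the
    old numerator reappears; the dual of the medial map adds one [vol_bipyramid R 4] per medial
    vertex. *)
Lemma nu_medial : (0 < #|D|)%N ->
  nu R (medial G) = 2 / 3 * nu R G + vol_bipyramid R 4.
Proof.
move=> D0; have dR : (#|D|%:R : R) != 0 by rewrite pnatr_eq0 -lt0n.
have cB : #|{: D * bool}|%:R = #|D|%:R * 2 :> R.
  by rewrite card_prod card_bool natrM.
have v2 : vol R (dual G) = #|D|%:R * beta 3.
  rewrite volE; under eq_bigr do rewrite order_turn_dual.
  by rewrite sumr_const mulr_natl.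
have v3 : vol R (dual (medial G)) = #|D|%:R * 2 * beta 4.
  rewrite volE; under eq_bigr do rewrite order_turn_dual_medial.
  by rewrite sumr_const -[LHS]mulr_natl cB.
have v4 : vol R (medial G) = #|D|%:R * beta 3 + vol R G.
  rewrite !volE.
  transitivity (\sum_(x : D) \sum_(b : bool) beta (order (turn (medial G)) (x, b))).
    by rewrite pair_bigA; apply: eq_bigr => -[].
  under eq_bigr do rewrite big_bool /= order_turn_medial_true order_turn_medial_false.
  by rewrite big_split sumr_const [in RHS]mulr_natl.
rewrite /nu (card_vertices _ order_rot) // (card_vertices _ order_rot_medial) //.
by rewrite cB v2 v3 v4 /beta; field.
Qed.

End Volumes.

(** * Numerical bounds *)

Section TaylorBounds.
Variable R : realType.
Implicit Types x : R.

(** Drives a chain of Taylor bounds for sine and cosine, each being the derivative of the next. *)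
Lemma ge0_of_derive (f df : R -> R) : (forall x, is_derive x 1 f (df x)) ->
  f 0 = 0 -> (forall x, 0 <= x -> 0 <= df x) -> forall x, 0 <= x -> 0 <= f x.
Proof.
move=> hf f0 df0 x x0; rewrite -f0.
have fd y : derivable f y 1 by have [] := hf y.
apply: (@ger0_derive1_ndecry R f 0) => //.
- move=> y; rewrite in_itv /= andbT => y0.
  by rewrite derive1E; have [_ ->] := hf y; apply/df0/ltW.
- by apply: continuous_subspaceT => y; apply: differentiable_continuous; exact/derivable1_diffP.
Qed.

Lemma is_derive_monomial k x :
  is_derive x 1 (fun y : R => y ^+ k.+1 / k.+1`!%:R) (x ^+ k / k`!%:R).
Proof.
have -> : (fun y : R => y ^+ k.+1 / k.+1`!%:R) = (k.+1`!%:R^-1 : R) \*: (id ^+ k.+1).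
  by apply/funext => y; rewrite /= /GRing.scale /= exprfctE mulrC.
apply: is_derive_eq.
rewrite /GRing.scale /= mulr1 factS natrM.
by field; rewrite nat1r !pnatr_eq0 -!lt0n fact_gt0.
Qed.

Lemma sin_lex x : 0 <= x -> 0 <= x - sin x.
Proof.
apply: (ge0_of_derive (f := fun y => y - sin y)
  (df := fun y => 1 - cos y)).
- by rewrite sin0 subr0.
- by move=> y _; rewrite subr_ge0 cos_le1.
Qed.

Let m k (x : R) := x ^+ k / k`!%:R.

Let m0 k : m k.+1 0 = 0. Proof. by rewrite /m expr0n mul0r. Qed.

Let m1 x : m 1 x = x. Proof. by rewrite /m expr1 divr1. Qed.

Let dm k x : is_derive x 1 (m k.+1) (m k x). Proof. exact: is_derive_monomial. Qed.

Lemma cos_ge2 x : 0 <= x -> 0 <= cos x - 1 + m 2 x.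
Proof.
apply: (ge0_of_derive (f := fun y => cos y - 1 + m 2 y)
  (df := fun y => - sin y - 0 + m 1 y)).
- move=> y;
  exact: (is_deriveD (is_deriveB (is_derive_cos y) (is_derive_cst (1 : R) y (1 : R))) (dm 1 y)).
- by rewrite cos0 subrr m0 addr0.
- by move=> y /sin_lex; rewrite m1; lra.
Qed.

Lemma sin_ge3 x : 0 <= x -> 0 <= sin x - x + m 3 x.
Proof.
apply: (ge0_of_derive (f := fun y => sin y - y + m 3 y)
  (df := fun y => cos y - 1 + m 2 y)).
- move=> y;
  exact: (is_deriveD (is_deriveB (is_derive_sin y) (is_derive_id y (1 : R))) (dm 2 y)).
- by rewrite sin0 subrr m0 addr0.
- exact: cos_ge2.
Qed.

Lemma cos_le4 x : 0 <= x -> 0 <= 1 - cos x - m 2 x + m 4 x.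
Proof.
apply: (ge0_of_derive (f := fun y => 1 - cos y - m 2 y + m 4 y)
  (df := fun y => 0 - - sin y - m 1 y + m 3 y)).
- move=> y;
  exact: (is_deriveD (is_deriveB (is_deriveB (is_derive_cst (1 : R) y (1 : R))
    (is_derive_cos y)) (dm 1 y)) (dm 3 y)).
- by rewrite cos0 subrr !m0 addr0 subr0.
- by move=> y /sin_ge3; rewrite m1; lra.
Qed.

Lemma sin_le5 x : 0 <= x -> 0 <= x - sin x - m 3 x + m 5 x.
Proof.
apply: (ge0_of_derive (f := fun y => y - sin y - m 3 y + m 5 y)
  (df := fun y => 1 - cos y - m 2 y + m 4 y)).
- move=> y;
  exact: (is_deriveD (is_deriveB (is_deriveB (is_derive_id y (1 : R))
    (is_derive_sin y)) (dm 2 y)) (dm 4 y)).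
- by rewrite sin0 subrr !m0 addr0 subr0.
- exact: cos_le4.
Qed.

Lemma cos_ge6 x : 0 <= x -> 0 <= cos x - 1 + m 2 x - m 4 x + m 6 x.
Proof.
apply: (ge0_of_derive (f := fun y => cos y - 1 + m 2 y - m 4 y + m 6 y)
  (df := fun y => - sin y - 0 + m 1 y - m 3 y + m 5 y)).
- move=> y;
  exact: (is_deriveD (is_deriveB (is_deriveD (is_deriveB (is_derive_cos y)
    (is_derive_cst (1 : R) y (1 : R))) (dm 1 y)) (dm 3 y)) (dm 5 y)).
- by rewrite cos0 subrr !m0 !addr0 subr0.
- by move=> y /sin_le5; rewrite m1; lra.
Qed.

Lemma sin_ge_cubic x : 0 <= x -> x - x ^+ 3 / 6 <= sin x.
Proof.
by move=> /sin_ge3; rewrite /m (_ : 3`!%:R = 6 :> R) //; lra.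
Qed.

(** Multiplying by the Taylor polynomial of [expR (- x)] makes the derivative collapse to the single
    term [expR x * m 3 x]. *)
Lemma expR_cubic x : 0 <= x -> 0 <= 1 - expR x * (1 - x + m 2 x - m 3 x).
Proof.
apply: (ge0_of_derive (f := fun y => 1 - expR y * (1 - y + m 2 y - m 3 y))
  (df := fun y => expR y * m 3 y)).
- move=> y.
  have dp := is_deriveB (is_deriveD (is_deriveB (is_derive_cst (1 : R) y (1 : R))
    (is_derive_id y (1 : R))) (dm 1 y)) (dm 2 y).
  have df := is_deriveB (is_derive_cst (1 : R) y (1 : R))
    (is_deriveM (is_derive_expR y) dp).
  apply: (is_derive_eq df).
  have -> : (cst 1 - id + m 2 - m 3) y = 1 - y + m 2 y - m 3 y :> R by [].
  by rewrite m1 /GRing.scale /=; ring.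
- by rewrite expR0 !m0 !subr0 addr0 mulr1 subrr.
- by move=> y y0; rewrite mulr_ge0 ?expR_ge0 // /m divr_ge0 ?exprn_ge0.
Qed.

(** Otherwise [y = pi / 2] has [y ^ 2 <= 49 / 20], where the sextic lower bound of cosine is still
    positive, against [cos y = 0]. *)
Lemma pi_gt : 313 / 100 < pi :> R.
Proof.
rewrite ltNge; apply/negP => ple.
have [/andP[y0 _] cy] := @pihalf_02_cos_pihalf R.
have := cos_ge6 y0; rewrite cy /m.
rewrite (_ : 2`!%:R = 2 :> R) // (_ : 4`!%:R = 24 :> R) // (_ : 6`!%:R = 720 :> R) //.
have y1 : pi / 2 <= 313 / 200 :> R by lra.
move: (pi / 2) y0 y1 => y y0 y1.
have z1 : y ^+ 2 <= 49 / 20.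
  have : 0 <= (313 / 200 - y) * (313 / 200 + y) by apply: mulr_ge0; lra.
  by rewrite expr2; lra.
have z0 : 0 <= y ^+ 2 by rewrite exprn_ge0.
have -> : y ^+ 4 = (y ^+ 2) ^+ 2 by rewrite -exprM.
have -> : y ^+ 6 = (y ^+ 2) ^+ 3 by rewrite -exprM.
move: (y ^+ 2) z0 z1 => z z0 z1 h.
have h1 : 0 <= (49 / 20 - z) * (1 / 2 - (z + 49 / 20) / 24).
  by rewrite mulr_ge0 //; lra.
have h2 : 0 <= (49 / 20 - z) * (z ^+ 2 + z * (49 / 20) + (49 / 20) ^+ 2).
  by rewrite mulr_ge0 ?subr_ge0 // !addr_ge0 ?exprn_ge0 ?mulr_ge0.
by move: h h1 h2; rewrite !exprS expr0; lra.
Qed.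

End TaylorBounds.

(** * The Lobachevsky function at a quarter of [pi] *)

Section Bipyramid4.
Variable R : realType.
Implicit Types x t a : R.

Let sqr_le (c s : R) : 0 <= c -> c <= s -> c ^+ 2 <= s ^+ 2.
Proof. by move=> c0 cs; rewrite lerXn2r ?nnegrE // (le_trans c0). Qed.

(** The argument is small enough for [expR_cubic]; the sixteenth power is reached by four squarings,
    rounded down in between. *)
Lemma expR_bound : 1 < 2299 / 100 * expR (- (122 / 625)) ^+ 16 :> R.
Proof.
have u0 : 0 <= 122 / 625 :> R by lra.
have := expR_cubic u0.
rewrite (_ : 2`!%:R = 2 :> R) // (_ : 3`!%:R = 6 :> R) //.
rewrite expRN; move: (expR _) (expR_gt0 (122 / 625 : R)) => e e0 he.
have t_ge (c : R) : c * e <= 1 -> c <= e^-1.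
  by move=> h; rewrite -[leRHS]mul1r ler_pdivlMr.
have t1 : 329 / 400 <= e^-1.
  by apply: t_ge; move: he; rewrite !exprS expr0; lra.
move: (e^-1) t1 => {e e0 he t_ge} t t1.
have := sqr_le _ t1; have -> : t ^+ 16 = (((t ^+ 2) ^+ 2) ^+ 2) ^+ 2 by rewrite -!exprM.
move: (t ^+ 2) => {t1} t1 h; have {h} : 1353 / 2000 <= t1.
  by apply: le_trans (h _); rewrite ?expr2; lra.
move=> h; have := sqr_le _ h; move: (t1 ^+ 2) => {h} t2 h.
have {h} : 183 / 400 <= t2 by apply: le_trans (h _); rewrite ?expr2; lra.
move=> h; have := sqr_le _ h; move: (t2 ^+ 2) => {h} t3 h.
have {h} : 209 / 1000 <= t3 by apply: le_trans (h _); rewrite ?expr2; lra.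
move=> h; have := sqr_le _ h; move: (t3 ^+ 2) => {h} t4 h.
have {h} : (209 / 1000) ^+ 2 <= t4 by apply: h; lra.
by rewrite expr2; lra.
Qed.

(** [b] is the lower bound of [pi / 2] given by [pi_gt]. The sides are separated by
    [16 * (122 / 625) = 3.1232], as [3 + b ^ 2 / 20] is about 3.1225 and [6 * b ^ 3] exceeds
    22.99. *)
Lemma ln_bound (b : R) : b = 313 / 200 -> 3 + b ^+ 2 / 20 < 3 * ln b + ln 6.
Proof.
move=> bE; have b0 : 0 < b by lra.
have -> : 3 * ln b + ln 6 = ln (b ^+ 3 * 6) by rewrite lnM ?posrE ?exprn_gt0 // lnXn // mulr_natl.
have [u uE] : exists u : R, u = 122 / 625 by exists (122 / 625).
have [c cE] : exists c : R, c = 2299 / 100 by exists (2299 / 100).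
apply: (@lt_trans _ _ (16 * u)); first by rewrite expr2; nra.
have bc : c <= b ^+ 3 * 6 by rewrite !exprS expr0 bE cE; lra.
have := expR_bound; rewrite -uE -cE expRN => h.
rewrite -ltr_expR lnK ?posrE; last by apply: mulr_gt0 => //; apply: exprn_gt0.
rewrite expRM_natl; apply: lt_le_trans bc.
have e0 : 0 < expR u ^+ 16 by rewrite exprn_gt0 // expR_gt0.
by move: h; rewrite exprVn ltr_pdivlMr // mul1r.
Qed.

(** A majorant of [- ln (sin t)] on []0, 1]]; [W] is its primitive that tends to 0 at 0. *)
Let w t : R := - ln t + t ^+ 2 / 5.

Let W t : R := t - t * ln t + t ^+ 3 / 15.

(** With [z = t ^ 2 <= 1], [- ln (1 - z / 6)] is at most [(z / 6) / (1 - z / 6)], hence at most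
    [z / 5]. *)
Lemma ln_sin_bound t : 0 < t -> t <= 1 -> ln 2 - w t <= ln `|2 * sin t|.
Proof.
move=> t0 t1; have t2 : t ^+ 2 <= 1 by rewrite expr_le1 // ltW.
have t20 : 0 <= t ^+ 2 by rewrite exprn_ge0 // ltW.
have y0 : 0 < 1 - t ^+ 2 / 6 by lra.
have st : t * (1 - t ^+ 2 / 6) <= sin t.
  by apply: le_trans (sin_ge_cubic (ltW t0)); rewrite !exprS expr0; lra.
have s0 : 0 < sin t by apply: lt_le_trans st; apply: mulr_gt0.
rewrite ger0_norm; last by rewrite mulr_ge0 // ltW.
rewrite lnM ?posrE // lerD2l.
apply: (@le_trans _ _ (ln (t * (1 - t ^+ 2 / 6)))); last first.
  by rewrite ler_ln ?posrE // mulr_gt0.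
rewrite lnM ?posrE // /w opprD opprK lerD2l.
have z0 : 0 < (1 - t ^+ 2 / 6)^-1 by rewrite invr_gt0.
rewrite lerNl -lnV ?posrE //.
have : ln (1 + ((1 - t ^+ 2 / 6)^-1 - 1)) <= (1 - t ^+ 2 / 6)^-1 - 1.
  by apply: le_ln1Dx; lra.
rewrite addrC subrK => /le_trans; apply.
rewrite lerBlDr -[leLHS]mul1r ler_pdivrMr //.
move: (t ^+ 2) t20 t2 => z z0' z1; nra.
Qed.

Local Notation mu := (@lebesgue_measure R).

Lemma w_ge0 t : 0 < t -> t <= 1 -> 0 <= w t.
Proof.
move=> t0 t1; rewrite /w addr_ge0 ?oppr_ge0 //; first by rewrite -ln1 ler_ln ?posrE.
by rewrite divr_ge0 // exprn_ge0 // ltW.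
Qed.

Lemma measurable_w (D : set R) : measurable_fun D w.
Proof.
apply/measurable_funTS; apply: measurable_funD.
  by apply: measurableT_comp.
by apply: measurable_funM.
Qed.

Lemma is_derive_W t : 0 < t -> is_derive t 1 W (w t).
Proof.
move=> t0.
have dl := is_derive1_ln t0.
have d1 := is_deriveM (is_derive_id t (1 : R)) dl.
have d3 := is_deriveM (is_deriveX 3 (is_derive_id t (1 : R))) (is_derive_cst (15^-1 : R) t (1 : R)).
have := is_deriveD (is_deriveB (is_derive_id t (1 : R)) d1) d3.
have -> : id - id * (@ln R) + id ^+ 3 * cst 15^-1 = W.
  by apply/funext => y; rewrite /W.
move=> h; apply: (is_derive_eq h).
rewrite /GRing.scale /= /w; field; exact: lt0r_neq0.
Qed.

Lemma W_segment e a : 0 < e -> e < a ->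
  (\int[mu]_(t in `[e, a]) (w t)%:E = (W a)%:E - (W e)%:E)%E.
Proof.
move=> e0 ea.
have cW t : 0 < t -> {for t, continuous W}.
  move=> t0; apply: differentiable_continuous; apply/derivable1_diffP.
  by have [] := is_derive_W t0.
apply: continuous_FTC2 => //.
- apply: continuous_in_subspaceT => t; rewrite inE /= in_itv /= => /andP[et _].
  have t0 : 0 < t by apply: lt_le_trans et.
  apply: cvgD; first by apply: cvgN; exact: continuous_ln.
  by apply: cvgM; [exact: exprn_continuous | exact: cvg_cst].
- split.
  + move=> t; rewrite in_itv /= => /andP[et _].
    by have [] := is_derive_W (lt_trans e0 et).
  + by apply: cvg_at_right_filter; exact: cW.
  + by apply: cvg_at_left_filter; apply: cW; exact: lt_trans ea.
- move=> t; rewrite in_itv /= => /andP[et _].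
  by rewrite derive1E; have [_ ->] := is_derive_W (lt_trans e0 et).
Qed.

Lemma W_ge0 t : 0 < t -> t <= 1 -> 0 <= W t.
Proof.
move=> t0 t1; rewrite /W addr_ge0 //; last by rewrite divr_ge0 // exprn_ge0 // ltW.
have : ln t <= 0 by rewrite -ln1 ler_ln ?posrE.
by nra.
Qed.

(** The integrand is singular at 0, so the interval is exhausted by segments [[a / (i + 2), a]], on
    which the primitive applies and its nonnegative value at the left end is dropped. *)
Lemma w_integral_le a : 0 < a -> a <= 1 ->
  (\int[mu]_(t in `]0%R, a]) (w t)%:E <= (W a)%:E)%E.
Proof.
move=> a0 a1.
pose F (i : nat) : set R := `[a / i.+2%:R, a]%classic.
have e0 i : 0 < a / i.+2%:R by rewrite divr_gt0.
have ea i : a / i.+2%:R < a by rewrite ltr_pdivrMr // ltr_pMr // ltr1n.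
have FU : (\bigcup_i F i = `]0%R, a])%classic.
  apply/seteqP; split=> t /=.
    by move=> [i _]; rewrite /F /= !in_itv /= => /andP[h ->]; rewrite (lt_le_trans (e0 i) h).
  rewrite in_itv /= => /andP[t0 ta].
  exists (Num.bound (a / t)) => //; rewrite /F /= in_itv /= ta andbT.
  rewrite ler_pdivrMr // mulrC -ler_pdivrMr //; apply: ltW.
  apply: lt_le_trans (archi_boundP _) _; first by rewrite divr_ge0 // ltW.
  by rewrite ler_nat -addn2 leq_addr.
have := @ge0_nondecreasing_set_cvg_integral _ (measurableTypeR R) R F (fun t => (w t)%:E) mu.
rewrite FU => cv; apply: (cvge_to_le (cv _ _ _ _)).
- apply/nondecreasing_seqP => n; apply/subsetPset => t; rewrite /F /= !in_itv /=.
  move=> /andP[h ->]; rewrite andbT; apply: le_trans h.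
  by rewrite ler_pM2l // lef_pV2 ?posrE // ler_nat.
- by move=> i; exact: measurable_itv.
- by move=> i; apply/measurable_EFinP; exact: measurable_w.
- move=> i t; rewrite /F /= in_itv /= => /andP[h ta]; rewrite lee_fin w_ge0 //.
    exact: lt_le_trans h.
  exact: le_trans a1.
apply: nearW => i; rewrite W_segment // -EFinB lee_fin lerBlDr lerDl.
by apply: W_ge0 => //; apply: le_trans (ltW (ea i)) a1.
Qed.

Lemma lobachevsky_le a : 0 < a -> a <= 1 -> lobachevsky a <= W a - a * ln 2.
Proof.
move=> a0 a1; set D : set (measurableTypeR R) := (`]0%R, a])%classic.
have mD : measurable D by exact: measurable_itv.
have inD t : D t -> 0 < t /\ t <= 1.
  by rewrite /D /= in_itv /= => /andP[? ta]; split=> //; exact: le_trans a1.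
have mw : measurable_fun D (EFin \o w) by apply/measurable_EFinP; exact: measurable_w.
have iw : mu.-integrable D (EFin \o w).
  apply/integrableP; split=> //.
  apply: le_lt_trans (ltry (W a)); apply: le_trans (w_integral_le a0 a1).
  apply: ge0_le_integral => //; first by apply: measurableT_comp.
  move=> t Dt; have [t0 t1] := inD t Dt.
  by rewrite /= ger0_norm // w_ge0.
have i2 : mu.-integrable D (EFin \o (cst (ln 2) : R -> R)).
  have i2c : mu.-integrable `[0, a] (EFin \o (cst (ln 2) : R -> R)).
    apply: continuous_compact_integrable; first exact: segment_compact.
    by apply: continuous_subspaceT => t; exact: cvg_cst.
  apply: integrableS i2c => //; apply: subset_itv_oc_cc.
pose f t : R := ln `|2 * sin t|.
have mf : measurable_fun D f.
  apply/measurable_funTS; apply: measurableT_comp => //.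
  apply: measurableT_comp => //; apply: measurable_funM => //.
  by apply: continuous_measurable_fun; exact: continuous_sin.
have ig : mu.-integrable D (EFin \o (fun t => ln 2 - w t)).
  have h := integrableB mD i2 iw.
  by apply: eq_integrable h => //; exact: mD.
(* This dominates [f] in absolute value; the integrability of [f] is what allows the integrals to be
   compared. *)
have ih : mu.-integrable D (EFin \o (fun t => ln 2 + w t)).
  have h := integrableD mD i2 iw.
  by apply: eq_integrable h => //; exact: mD.
have fle t : D t -> ln 2 - w t <= f t by move=> /inD[t0 t1]; exact: ln_sin_bound.
have fge t : D t -> f t <= ln 2.
  move=> /inD[t0 t1].
  have s0 : 0 < sin t by apply: sin_gt0_pi; have := pi_ge2 R; lra.
  rewrite /f ger0_norm ?ler_ln ?posrE ?mulr_gt0 //; last by rewrite mulr_ge0 // ltW.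
  by rewrite -[leRHS]mulr1 ler_pM2l // sin_le1.
have l2 : 0 <= ln 2 :> R by apply: ln_ge0; rewrite ler1n.
have if_ : mu.-integrable D (EFin \o f).
  apply: le_integrable ih => //; first exact/measurable_EFinP.
  move=> t Dt; have [t0 t1] := inD t Dt; have w0 := w_ge0 t0 t1.
  have h : `|f t| <= ln 2 + w t.
    by have := fle t Dt; have := fge t Dt; rewrite ler_norml; lra.
  by rewrite /= lee_fin (le_trans h) // ler_norm.
have Rw : \int[mu]_(t in D) w t <= W a.
  by rewrite -lee_fin /Rintegral fineK ?w_integral_le //; exact: integrable_fin_num.
rewrite /lobachevsky -Rintegral_itv_obnd_cbnd // -/D.
rewrite lerNl opprB; apply: (@le_trans _ _ (\int[mu]_(t in D) (ln 2 - w t))); last first.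
  exact: le_Rintegral.
rewrite RintegralB // lerB //.
have muD : mu D = a%:E.
  by rewrite /D lebesgue_measure_itv /= lte_fin a0 -EFinB subr0.
have fD : fine (mu D) = a by rewrite muD.
rewrite Rintegral_cst // -[X in X * _ <= _]fD mulrC; exact: lexx.
Qed.

(** With [a = pi / 4], [lobachevsky_le] reduces the claim to [key]. [ln_bound] is [key] with [2a]
    replaced by the smaller [b]. *)
Lemma vol_bipyramid4_lt : vol_bipyramid R 4 < 2 * pi / 3 * ln 6.
Proof.
have [a aE] : exists a : R, a = pi / 4%:R by exists (pi / 4%:R).
have pa : pi = 4 * a by rewrite aE mulrC divfK.
have a0 : 313 / 400 < a by rewrite aE; have := pi_gt R; lra.
have a1 : a < 1 by have := pihalf_lt2 R; rewrite pa; lra.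
have ap : 0 < a by have := pi_gt0 R; rewrite pa; lra.
have L := lobachevsky_le ap (ltW a1).
have [b bE] : exists b : R, b = 313 / 200 by exists (313 / 200).
have lb := ln_bound bE.
have b0 : 0 < b by lra.
(* The inequality [ln x >= 1 - 1 / x] at [x = 2a / b]. *)
have lna : ln b + (1 - b / (2 * a)) <= ln 2 + ln a.
  rewrite -lnM ?posrE // -lerBrDl -ln_div ?posrE ?mulr_gt0 //.
  have r0 : 0 < b / (2 * a) by rewrite divr_gt0 // mulr_gt0.
  rewrite -[_ / b]invf_div lnV ?posrE // lerNr opprB.
  have : ln (1 + (b / (2 * a) - 1)) <= b / (2 * a) - 1 by apply: le_ln1Dx; lra.
  by rewrite addrC subrK.
have key : 3 + a ^+ 2 / 5 < 3 * (ln 2 + ln a) + ln 6.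
  (* Passing from [b] to [2a], the gain in the logarithm outweighs the growth of the quadratic
     term. *)
  have e : 0 <= 3 * (1 - b / (2 * a)) - (a ^+ 2 / 5 - b ^+ 2 / 20).
    have -> : 3 * (1 - b / (2 * a)) - (a ^+ 2 / 5 - b ^+ 2 / 20) =
       (2 * a - b) * (3 / (2 * a) - (2 * a + b) / 20).
      by field; exact: lt0r_neq0.
    apply: mulr_ge0; first by lra.
    have : 3 / 2 <= 3 / (2 * a).
      by rewrite ler_pM2l // lef_pV2 ?posrE ?mulr_gt0 //; lra.
    lra.
  lra.
rewrite /vol_bipyramid -aE pa.
have : W a - a * ln 2 < a / 3 * ln 6.
  rewrite /W.
  have -> : a - a * ln a + a ^+ 3 / 15 - a * ln 2 = a * (1 - ln a + a ^+ 2 / 15 - ln 2) by ring.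
  rewrite -mulrA ltr_pM2l //; lra.
have -> : 2 * (4 * a) / 3 * ln 6 = 8 * (a / 3 * ln 6) :> R by field.
have -> : 2 * 4%:R * lobachevsky a = 8 * lobachevsky a :> R by ring.
move=> h; rewrite ltr_pM2l //; exact: le_lt_trans h.
Qed.

End Bipyramid4.

(** * The theorem *)

(** An empty drawing would still have a face, which could not be the side of any dart. *)
Lemma planar_lattice_graph_inhabited (R : realType) (E : Type)
    (M : lattice_map E) (u v : plane R) (d : drawing R E) :
  planar_lattice_graph u v M d -> inhabited E.
Proof.
move=> hd; apply: contrapT => nE.
have : plane_faces d (connected_component (~` Defs.support d) (0, 0))%classic.
  by exists (0, 0) => // -[x _]; case: nE; exists.
by rewrite -(plg_faces hd) => -[x _]; case: nE; exists.
Qed.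

(** A fixed point of [rot G] would make [rot M x] a translate of [x]; both lie in the same cell, so
    the translation is zero. *)
Lemma quotient_regular3 (E : choiceType) (D : finType) (M : lattice_map E)
    (G : cmap D) (p : E -> D) (F : {fset E}) :
  is_quotient M G p -> regular M 3 -> fundamental_domain M F ->
  forall x, rot G (rot G (rot G x)) = x /\ rot G x <> x.
Proof.
move=> [psurj porb prot _] M3 /exists_cell[c [cD cr _]] d; have [x <-] := psurj d.
have [r3 r1] := regular3_rot M3 x; rewrite -!prot r3; split=> // /porb[k xk].
have := congr1 c xk; rewrite cD cr -[LHS]add0r => /addIr k0.
by case: r1; rewrite [RHS]xk -k0 act0.
Qed.

Theorem theorem14 (R : realType) (E : choiceType) (D : finType)
    (M : lattice_map E) (G : cmap D) (p : E -> D)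
    (u v : plane R) (d d' : drawing R E)
    (F : {fset E}) (F' : {fset (E * bool)}) :
  planar_lattice_graph u v M d ->
  is_quotient M G p ->
  regular M 3 ->
  planar_lattice_graph u v (ldual M) d' ->
  dual_drawing M d d' ->
  two_connected G -> two_connected (dual G) ->
  disk_faces M d -> disk_faces (ldual M) d' ->
  fundamental_domain M F ->
  fundamental_domain (lmedial M) F' ->
  nu R G <= 2 * pi * entropy M R F ->
  nu R (medial G) < 2 * pi * entropy (lmedial M) R F'.
Proof.
move=> hd hp M3 _ _ _ _ _ _ hF hF' hnu.
have [x0] := planar_lattice_graph_inhabited hd.
have rot3 x := (regular3_rot M3 x).1; have rot1 x := (regular3_rot M3 x).2.
have Grot3 x := (quotient_regular3 hp M3 hF x).1.
have Grot1 x := (quotient_regular3 hp M3 hF x).2.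
have [c hc] := exists_cell hF; have [c' hc'] := exists_cell hF'.
have cF := card_fundamental hc hp.
have cF' := card_fundamental hc' (is_quotient_medial hp).
have D0 : (0 < #|D|)%N by apply/card_gt0P; exists (p x0).
have [L [hL1 hL2]] := forests_limit R hc.
have [L' [hL1' hL2']] := forests_limit R hc'.
have LL' := medial_limit_ge M3 hF hc hc' hL2 hL1'.
have hV n : #|` region M F (boxes n)| =
    (3 * #|` sub_vertices M (region M F (boxes n))|)%N.
  apply: (card_sub_vertices (blk := star M)).
    by apply: star_system => // x; exact: region_rot hc _ _.
  by move=> x y; exact: starP.
have hV' n : #|` region (lmedial M) F' (boxes n)| =
    (4 * #|` sub_vertices (lmedial M) (region (lmedial M) F' (boxes n))|)%N.
  apply: (card_sub_vertices (blk := medial_star M)).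
    by apply: medial_star_system => a; exact: region_rot hc' _ _.
  by move=> a b; exact: medial_starP.
rewrite card_prod card_bool in cF'.
have F0 : (0 < #|` F|)%N by rewrite cF.
have F0' : (0 < #|` F'|)%N by rewrite cF' muln_gt0 D0.
rewrite (entropy_eq hc' (ltn0Sn 3) F0' hF' hV' hL1' hL2') cF'.
rewrite (entropy_eq hc (ltn0Sn 2) F0 hF hV hL1 hL2) cF in hnu.
rewrite nu_medial //.
have B4 := vol_bipyramid4_lt R.
have dR : 0 < #|D|%:R :> R by rewrite ltr0n.
rewrite cF in LL'; rewrite natrM.
(* A medial vertex has four darts and a fundamental domain twice as many darts as before, so the
   entropies are [3 L / #|D|] and [2 L' / #|D|]. *)
have -> : 4%:R * L' / (#|D|%:R * 2%:R) = 2 * (L' / #|D|%:R) :> R.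
  by field; rewrite gt_eqF.
have h : L / #|D|%:R + ln 6 / 6 <= L' / #|D|%:R.
  rewrite ler_pdivlMr // mulrDl divfK ?gt_eqF //; move: LL'.
  by rewrite [_ / 6 * _]mulrAC [_ * ln 6]mulrC [_ * _ / 6]mulrAC.
have : 2 * pi * (2 * (L / #|D|%:R + ln 6 / 6)) <= 2 * pi * (2 * (L' / #|D|%:R)).
  by rewrite !ler_pM2l // mulr_gt0 // pi_gt0.
move: hnu B4; rewrite -[3%:R * L / _]mulrA.
move: (L / #|D|%:R) (L' / #|D|%:R) (nu R G) (vol_bipyramid R 4) (ln 6) pi {h LL'} => a b n w l q.
lra.
Qed.
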